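(* Given query access to an $n$-vertex graph $G$ in the general graph query model, there is a randomized algorithm that, with high probability, produces a proper coloring of $G$ using $\kappa(G)+o(\kappa(G))$ colors. The algorithm's worst-case query complexity, running time, and space usage are all $\widetilde{O}(n^{3/2})$.
   Context: In the general graph query model the algorithm knows the vertex set $[n]$ and may access $G$ only through pair queries $\mathrm{Pair}(u,v)$, returning 1 if $\{u,v\}\in E(G)$ and 0 otherwise, and neighbor queries $\mathrm{Nbr}(u,j)$ for $j\in[n-1]$, returning the $j$th neighbor of $u$ in some fixed ordering of its adjacency list, or $\bot$ if $u$ has fewer than $j$ neighbors. $\kappa(G)$ is the degeneracy of $G$ (least $k$ such that every induced subgraph has a vertex of degree at most $k$). $\widetilde{O}$ hides polylogarithmic factors in $n$; high probability means at least $1-1/\mathrm{poly}(n)$. *)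

(* Defs.v *)
From HB Require Import structures.
From mathcomp Require Import all_boot all_order all_algebra.
From mathcomp Require Import all_classical all_reals all_analysis.

Set Implicit Arguments.
Unset Strict Implicit.
Unset Printing Implicit Defensive.

Import Order.TTheory GRing.Theory Num.Theory numFieldNormedType.Exports.

Local Open Scope nat_scope.

(** ** Graphs *)

Definition simple_graph (V : finType) (e : rel V) : Prop :=
  symmetric e /\ irreflexive e.

Definition adjacency_lists (V : finType) (e : rel V) (adj : V -> seq V) : Prop :=
  forall u, uniq (adj u) /\ forall v, (v \in adj u) = e u v.

Definition proper_coloring (V : finType) (e : rel V) (col : V -> nat) : Prop :=
  forall u v, e u v -> col u <> col v.

Definition num_colors (V : finType) (col : V -> nat) : nat :=
  size (undup (codom col)).

Definition degenerate (V : finType) (e : rel V) (k : nat) : bool :=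
  [forall S : {set V}, (S != finset.set0) ==>
     [exists u in S, #|[set v in S | e u v]| <= k]].

Lemma degenerate_exists (V : finType) (e : rel V) : exists k, degenerate e k.
Proof.
exists #|V|; apply/forallP => S; apply/implyP => /set0Pn[u Su].
by apply/existsP; exists u; rewrite Su max_card.
Qed.

Definition degeneracy (V : finType) (e : rel V) : nat :=
  ex_minn (degenerate_exists e).

(** ** Random-access machine under the logarithmic cost criterion

   Programs work on finitely many arrays of natural numbers, all cells being
   initially 0; a scalar variable is an array that is used only at index 0.
   Integers are unbounded, but every operation is charged the bit lengths of
   its operands (the logarithmic cost of Aho, Hopcroft and Ullman), and memory
   is measured in bits. This agrees with unit cost on words of O(log n) bits
   up to factors that are polylogarithmic in n. *)

Inductive binop := Add | Sub | Mul | Div | Eq | Lt.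

Inductive expr :=
  | Const of nat
  | Get of nat & expr
  | Op of binop & expr & expr.

Inductive cmd :=
  | Skip
  | Assign of nat & expr & expr
  | Seq of cmd & cmd
  | If of expr & cmd & cmd
  | While of expr & cmd
  | Flip of nat
  | AskPair of nat & expr & expr
  | AskNbr of nat & expr & expr.

Definition bitlen (n : nat) : nat := (trunc_log 2 n).+1.

Definition binop_val (o : binop) (a b : nat) : nat :=
  match o with
  | Add => a + b
  | Sub => a - b
  | Mul => a * b
  | Div => a %/ b
  | Eq => a == b
  | Lt => a < b
  end.

Definition memory := nat -> nat -> nat.

Fixpoint eval (m : memory) (x : expr) : nat :=
  match x with
  | Const k => k
  | Get a i => m a (eval m i)
  | Op o y z => binop_val o (eval m y) (eval m z)
  end.

Fixpoint cost (m : memory) (x : expr) : nat :=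
  match x with
  | Const k => bitlen k
  | Get a i => cost m i + bitlen (eval m i) + bitlen (m a (eval m i))
  | Op _ y z => cost m y + cost m z + bitlen (eval m y) + bitlen (eval m z)
  end.

(* [st_cells] lists the cells (array, index) written so far, and [st_space] is
   the largest memory size, in bits, reached so far. *)
Record state := State {
  st_mem : memory;
  st_cells : seq (nat * nat);
  st_coins : nat;
  st_queries : nat;
  st_time : nat;
  st_space : nat }.

Definition memory_size (m : memory) (cells : seq (nat * nat)) : nat :=
  \sum_(p <- undup cells) (bitlen p.2 + bitlen (m p.1 p.2)).

Definition charge (t : nat) (s : state) : state :=
  State (st_mem s) (st_cells s) (st_coins s) (st_queries s)
        (st_time s + t) (st_space s).

Definition count_coin (s : state) : state :=
  State (st_mem s) (st_cells s) (st_coins s).+1 (st_queries s)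
        (st_time s) (st_space s).

Definition count_query (s : state) : state :=
  State (st_mem s) (st_cells s) (st_coins s) (st_queries s).+1
        (st_time s) (st_space s).

Definition update (m : memory) (a i v : nat) : memory :=
  fun b j => if (b == a) && (j == i) then v else m b j.

Definition store (a i v : nat) (s : state) : state :=
  let m := update (st_mem s) a i v in
  let cells := (a, i) :: st_cells s in
  charge (1 + bitlen i + bitlen v)
    (State m cells (st_coins s) (st_queries s) (st_time s)
       (maxn (st_space s) (memory_size m cells))).

(* [exec pairq nbrq w c s s']: started in [s] with query answers [pairq] and
   [nbrq] and coin tosses [w], the program [c] halts in state [s']. *)
Inductive exec (pairq nbrq : nat -> nat -> nat) (w : nat -> bool) :
    cmd -> state -> state -> Prop :=
  | exec_skip s : exec pairq nbrq w Skip s (charge 1 s)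
  | exec_assign a i x s :
      let m := st_mem s in
      exec pairq nbrq w (Assign a i x) s
        (store a (eval m i) (eval m x) (charge (cost m i + cost m x) s))
  | exec_seq c1 c2 s s1 s2 :
      exec pairq nbrq w c1 s s1 -> exec pairq nbrq w c2 s1 s2 ->
      exec pairq nbrq w (Seq c1 c2) s s2
  | exec_if x c1 c2 s s1 :
      let m := st_mem s in
      exec pairq nbrq w (if eval m x != 0 then c1 else c2)
        (charge (cost m x).+1 s) s1 ->
      exec pairq nbrq w (If x c1 c2) s s1
  | exec_while_stop x c s :
      let m := st_mem s in
      eval m x = 0 ->
      exec pairq nbrq w (While x c) s (charge (cost m x).+1 s)
  | exec_while_step x c s s1 s2 :
      let m := st_mem s in
      eval m x <> 0 ->
      exec pairq nbrq w c (charge (cost m x).+1 s) s1 ->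
      exec pairq nbrq w (While x c) s1 s2 ->
      exec pairq nbrq w (While x c) s s2
  | exec_flip a s :
      exec pairq nbrq w (Flip a) s
        (store a 0 (w (st_coins s)) (count_coin s))
  | exec_pair a x y s :
      let m := st_mem s in
      exec pairq nbrq w (AskPair a x y) s
        (store a 0 (pairq (eval m x) (eval m y))
           (count_query
              (charge (cost m x + cost m y
                       + bitlen (eval m x) + bitlen (eval m y)) s)))
  | exec_nbr a x y s :
      let m := st_mem s in
      exec pairq nbrq w (AskNbr a x y) s
        (store a 0 (nbrq (eval m x) (eval m y))
           (count_query
              (charge (cost m x + cost m y
                       + bitlen (eval m x) + bitlen (eval m y)) s))).

(** ** The general graph query model

   The vertex set [n] = {1, ..., n} is represented by ['I_n], the vertex
   [u : 'I_n] having the machine name [u.+1]. The machine name 0 stands for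
   the answer "bottom" to a neighbor query; the list positions are numbered
   from 1. *)

Definition vertex (n : nat) (u : nat) : option 'I_n :=
  if u is i.+1 then insub i else None.

Definition pair_query (n : nat) (e : rel 'I_n) (u v : nat) : nat :=
  match vertex n u, vertex n v with
  | Some x, Some y => e x y
  | _, _ => 0
  end.

Definition nbr_query (n : nat) (adj : 'I_n -> seq 'I_n) (u j : nat) : nat :=
  if vertex n u is Some x then
    nth 0 (0 :: [seq (nat_of_ord y).+1 | y <- adj x]) j
  else 0.

(* The only input is the number [n], in the scalar 0. *)
Definition input_state (n : nat) : state :=
  let m := update (fun _ _ => 0) 0 0 n in
  let cells := [:: (0, 0)] in
  State m cells 0 0 0 (memory_size m cells).

(* The color of each vertex is left in array 1. *)
Definition output_coloring (n : nat) (s : state) (u : 'I_n) : nat :=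
  st_mem s 1 u.+1.

Definition run (n : nat) (e : rel 'I_n) (adj : 'I_n -> seq 'I_n)
    (prog : cmd) (w : nat -> bool) (s : state) : Prop :=
  exec (pair_query e) (nbr_query adj) w prog (input_state n) s.

Definition coin_stream (m : nat) (r : m.-tuple bool) : nat -> bool :=
  fun i => nth false r i.

Local Open Scope ring_scope.

(* Probability of an event for [m] independent fair coin tosses. Each toss takes
   at least one unit of time, so a run of time at most [m] depends only on the
   first [m] tosses. *)
Definition coin_prob (R : realType) (m : nat) (E : (nat -> bool) -> Prop) : R :=
  #|[set r : m.-tuple bool | `[< E (coin_stream r) >]]|%:R / 2 ^+ m.

Local Open Scope classical_set_scope.

Definition little_o (R : realType) (f g : nat -> R) : Prop :=
  f =o_\oo g.

Definition soft_O (R : realType) (f g : nat -> R) : Prop :=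
  exists k : nat, f =O_\oo (fun n => g n * ln n%:R ^+ k).

(* Main.v *)
From Pilot Require Import Defs.
From HB Require Import structures.
From mathcomp Require Import all_boot all_order all_algebra.
From mathcomp Require Import all_classical all_reals all_analysis.
From mathcomp Require Import zify ring lra.
(* [all_analysis] shadows [eval]. *)
Import Pilot.Defs.

(** The vertices are cut into groups of [l = 2 ^ q] consecutive vertices, with
    [l] of order [sqrt n / polylog n], and each group gets a random cyclic shift;
    block [b] contains the vertex at position [b + shift] (mod [l]) of every group.
    All blocks have at most [n / l + 1] vertices whatever the coins are, so asking
    all pairs inside blocks costs [n ^ (3/2)] up to polylogarithmic factors in the
    worst case. Fix an elimination order witnessing the degeneracy [k]. A vertex has
    at most [k] later neighbors, and the number of those that fall in a given block
    is a sum of independent indicators, one per group, of mean at most [k / l]. If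
    [k >= tau q], a Chernoff bound shows that with high probability all these
    numbers are at most [d = k (1 + 1/q) / l]. Then the graph of edges inside
    blocks is [d]-degenerate; coloring it greedily in reverse elimination order, with
    a separate palette for each block, uses at most [l (d + 1) <= k + 2 k / q] colors.
    If [k < tau q], there are few edges and reading all the adjacency lists, within
    a budget of [2 n tau q] neighbors, already gives a coloring with [k + 1] colors.
    Exhausting the budget certifies [k >= tau q], so [k] need not be known.

    Every loop of the program has a loop-free body. Its time is therefore bounded by
    an initial potential times the bit length of the largest value; queries and
    space are bounded by time for every program. *)

Set Implicit Arguments.
Unset Strict Implicit.
Unset Printing Implicit Defensive.

Import Order.TTheory GRing.Theory Num.Theory numFieldNormedType.Exports.
Local Open Scope nat_scope.

(** * Time-bounded total correctness *)

(** Each vertex matters in its own block, but that block depends on the coins. The union bound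
    therefore runs over all pairs of a vertex and a fixed label [b]: for fixed [b] the indicator of
    a group depends on the shift of that group alone, and as [l] is a power of two, [q] coins make
    the shift exactly uniform. The elimination order used in this count is fixed before any toss;
    the order found by the program depends on the coins and enters only through the minimality of
    its degeneracy bound. The choice [tau D q = 2 ^ D * q ^ 3 * 2 ^ q] meets two demands. With
    relative slack [1 / q] the Chernoff exponent is of order [k / (q ^ 2 * l)], so [k >= tau] makes
    it of order [2 ^ D * q], which exceeds any fixed multiple of [ln n] once [D] is large. And [tau]
    close to [sqrt n] balances the reading budget [n * tau] with the [n * (n / l)] pair queries. The
    surplus of colors may depend on [k] only, whereas the program works with the [q] belonging to
    [n]; monotonicity of [qlog] and [k <= n] settle this. *)

Lemma bitlen_gt0 n : 0 < bitlen n.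
Proof. by []. Qed.

Lemma ltn_exp_bitlen n : n < 2 ^ bitlen n.
Proof. exact: trunc_log_ltn. Qed.

Lemma leq_bitlen m n : m <= n -> bitlen m <= bitlen n.
Proof. by move=> h; rewrite ltnS; apply: leq_trunc_log. Qed.

Lemma bitlen_leq m k : 0 < k -> m < 2 ^ k -> bitlen m <= k.
Proof.
case: m => [|m] k0 h; first by rewrite /bitlen trunc_log0.
have := @trunc_logP 2 m.+1 isT isT; rewrite /bitlen => h2.
by have := leq_ltn_trans h2 h; rewrite ltn_exp2l.
Qed.

Lemma bitlen_binop o a b : bitlen (binop_val o a b) <= bitlen a + bitlen b.
Proof.
have [ha hb] := (ltn_exp_bitlen a, ltn_exp_bitlen b).
have p1 m : 2 <= 2 ^ bitlen m by rewrite -{1}(expn1 2) leq_exp2l.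
move: (p1 a) (p1 b) => pa pb.
have le1 (c : bool) : bitlen c <= bitlen a + bitlen b.
  apply: bitlen_leq => //; apply: (@leq_ltn_trans 1); first by case: c.
  by rewrite expnD; nia.
case: o => //=.
- by apply: bitlen_leq => //; rewrite expnD; nia.
- by apply: leq_trans (leq_addr _ _); apply: leq_bitlen; rewrite leq_subr.
- by apply: bitlen_leq => //; rewrite expnD; apply: ltn_mul.
- by apply: leq_trans (leq_addr _ _); apply: leq_bitlen; rewrite leq_div.
Qed.

(** Coefficient of [L] in the bit length of the value when cells hold at most [L] bits: under every
    operation, multiplication included, bit lengths at worst add. *)
Fixpoint esize (x : expr) : nat :=
  match x with
  | Const k => bitlen k
  | Get _ _ => 1
  | Op _ y z => esize y + esize z
  end.

Fixpoint ecost (x : expr) : nat :=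
  match x with
  | Const k => bitlen k
  | Get _ i => ecost i + esize i + 1
  | Op _ y z => ecost y + ecost z + esize y + esize z
  end.

Definition bits_le (L : nat) (m : memory) : Prop :=
  forall a i, bitlen (m a i) <= L.

Lemma bitlen_eval L m x : 0 < L -> bits_le L m -> bitlen (eval m x) <= esize x * L.
Proof.
move=> L0 hm; elim: x => [k|a i _|o y hy z hz] /=.
- by rewrite -{1}(muln1 (bitlen k)) leq_mul2l L0 orbT.
- by rewrite mul1n.
- by apply: leq_trans (bitlen_binop _ _ _) _; rewrite mulnDl leq_add.
Qed.

Lemma cost_le L m x : 0 < L -> bits_le L m -> cost m x <= ecost x * L.
Proof.
move=> L0 hm; elim: x => [k|a i hi|o y hy z hz] /=.
- by rewrite -{1}(muln1 (bitlen k)) leq_mul2l L0 orbT.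
- by rewrite !mulnDl mul1n !leq_add // bitlen_eval.
- by rewrite !mulnDl !leq_add // bitlen_eval.
Qed.

Fixpoint loop_free (c : cmd) : bool :=
  match c with
  | Seq c1 c2 | If _ c1 c2 => loop_free c1 && loop_free c2
  | While _ _ => false
  | _ => true
  end.

(* A loop-free command started with values of at most [L] bits leaves values of
   at most [grow c * L] bits and takes time at most [kost c * L]. *)
Fixpoint grow (c : cmd) : nat :=
  match c with
  | Assign _ _ x => (esize x).+1
  | Seq c1 c2 => grow c1 * grow c2
  | If _ c1 c2 => grow c1 + grow c2
  | _ => 1
  end.

Fixpoint kost (c : cmd) : nat :=
  match c with
  | Skip => 1
  | Assign _ i x => ecost i + ecost x + esize i + esize x + 1
  | Seq c1 c2 => kost c1 + grow c1 * kost c2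
  | If x c1 c2 => ecost x + 1 + kost c1 + kost c2
  | While x c => 2 * (ecost x + 1 + kost c)
  | Flip _ => 3
  | AskPair _ x y | AskNbr _ x y => ecost x + ecost y + esize x + esize y + 3
  end.

Lemma grow_gt0 c : 0 < grow c.
Proof. by elim: c => //= [c1 h1 c2 h2|x c1 h1 c2 h2]; lia. Qed.

Lemma bits_le_update L m a i v :
  bits_le L m -> bitlen v <= L -> bits_le L (update m a i v).
Proof. by move=> hm hv b j; rewrite /update; case: ifP. Qed.

Lemma bits_le_trans L L' m : L <= L' -> bits_le L m -> bits_le L' m.
Proof. by move=> h hm a i; apply: leq_trans h. Qed.

Section Logic.

Variables (pq nq : nat -> nat -> nat) (w : nat -> bool).

(** A computable semantics on memory and number of tossed coins: the body of a loop is then run by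
    simplification, without inverting [exec]. *)
Fixpoint step (c : cmd) (x : memory * nat) : memory * nat :=
  match c with
  | Skip => x
  | Assign a i e => (update x.1 a (eval x.1 i) (eval x.1 e), x.2)
  | Seq c1 c2 => step c2 (step c1 x)
  | If e c1 c2 => if eval x.1 e != 0 then step c1 x else step c2 x
  | While _ _ => x
  | Flip a => (update x.1 a 0 (w x.2), x.2.+1)
  | AskPair a e f => (update x.1 a 0 (pq (eval x.1 e) (eval x.1 f)), x.2)
  | AskNbr a e f => (update x.1 a 0 (nq (eval x.1 e) (eval x.1 f)), x.2)
  end.

Lemma exec_loop_free c s L : loop_free c -> 0 < L ->
  (forall u v, bitlen (pq u v) <= L) -> (forall u v, bitlen (nq u v) <= L) ->
  bits_le L (st_mem s) ->
  exists s', [/\ exec pq nq w c s s',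
    (st_mem s', st_coins s') = step c (st_mem s, st_coins s),
    st_time s' <= st_time s + kost c * L & bits_le (grow c * L) (st_mem s')].
Proof.
have b0 : bitlen 0 = 1 by rewrite /bitlen trunc_log0.
elim: c s L => [|a i x|c1 h1 c2 h2|x c1 h1 c2 h2|x c _|a|a x y|a x y] //= s L;
    move=> lf L0 hp hn hm.
- by exists (charge 1 s); split => //=; [exact: exec_skip | lia | rewrite mul1n].
- eexists; split; [exact: exec_assign | by [] | |] => /=.
    have := cost_le i L0 hm; have := cost_le x L0 hm.
    have := bitlen_eval i L0 hm; have := bitlen_eval x L0 hm; nia.
  apply: bits_le_update; first by apply: bits_le_trans hm; nia.
  by have := bitlen_eval x L0 hm; nia.
- case/andP: lf => lf1 lf2.
  have [s1 [e1 m1 t1 b1]] := h1 _ _ lf1 L0 hp hn hm.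
  have leL : L <= grow c1 * L by rewrite leq_pmull // grow_gt0.
  have L1 : 0 < grow c1 * L by apply: leq_trans leL.
  have [||s2 [e2 m2 t2 b2]] := h2 s1 _ lf2 L1 _ _ b1.
  + by move=> u v; apply: leq_trans leL.
  + by move=> u v; apply: leq_trans leL.
  exists s2; split; [exact: exec_seq e1 e2 | by rewrite m2 m1 | nia |].
  by apply: bits_le_trans b2; nia.
- case/andP: lf => lf1 lf2.
  have := cost_le x L0 hm => cx.
  have := @exec_if pq nq w x c1 c2 s => /= ei.
  case: ifP ei => ex ei.
  + have [s1 [e1 m1 t1 b1]] := h1 (charge (cost (st_mem s) x).+1 s) _ lf1 L0 hp hn hm.
    exists s1; split; [exact: ei | by [] | by move: t1 => /=; nia|].
    by apply: bits_le_trans b1; nia.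
  + have [s1 [e1 m1 t1 b1]] := h2 (charge (cost (st_mem s) x).+1 s) _ lf2 L0 hp hn hm.
    exists s1; split; [exact: ei | by [] | by move: t1 => /=; nia|].
    by apply: bits_le_trans b1; nia.
- have b1 (b : bool) : bitlen b = 1 by case: b; rewrite /bitlen ?trunc_log1 ?trunc_log0.
  eexists; split; [exact: exec_flip | by [] | |] => /=.
    by rewrite (b1 false) b1; nia.
  by rewrite mul1n; apply: bits_le_update => //; rewrite b1.
- eexists; split; [exact: exec_pair | by [] | |] => /=.
    have := cost_le x L0 hm; have := cost_le y L0 hm.
    have := bitlen_eval x L0 hm; have := bitlen_eval y L0 hm.
    have := hp (eval (st_mem s) x) (eval (st_mem s) y).
    by rewrite b0; nia.
  by rewrite mul1n; apply: bits_le_update.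
- eexists; split; [exact: exec_nbr | by [] | |] => /=.
    have := cost_le x L0 hm; have := cost_le y L0 hm.
    have := bitlen_eval x L0 hm; have := bitlen_eval y L0 hm.
    have := hn (eval (st_mem s) x) (eval (st_mem s) y).
    by rewrite b0; nia.
  by rewrite mul1n; apply: bits_le_update.
Qed.

Definition bounded (B : nat) (m : memory) : Prop := forall a i, m a i <= B.

Lemma bounded_update B m a i v :
  bounded B m -> v <= B -> bounded B (update m a i v).
Proof. by move=> hm hv b j; rewrite /update; case: ifP. Qed.

Lemma bounded_bits B m : bounded B m -> bits_le (bitlen B) m.
Proof. by move=> h a i; apply: leq_bitlen. Qed.

Variables (B F : nat).
Hypotheses (F0 : 0 < F) (pqB : forall u v, pq u v <= B) (nqB : forall u v, nq u v <= B).

(** [B] bounds every value and [F] the initial potential of every loop. Both are fixed for the whole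
    program, so that all costs share one factor and add up along [Seq]. *)
Definition triple (P : memory -> nat -> Prop) (c : cmd) (Q : memory -> nat -> Prop) :=
  forall s, P (st_mem s) (st_coins s) ->
  exists s', [/\ exec pq nq w c s s', Q (st_mem s') (st_coins s')
    & st_time s' <= st_time s + kost c * (bitlen B * F)].

Lemma triple_flat (P Q : memory -> nat -> Prop) c : loop_free c ->
  (forall m k, P m k -> bounded B m) ->
  (forall m k, P m k -> Q (step c (m, k)).1 (step c (m, k)).2) -> triple P c Q.
Proof.
move=> lf hB hQ s hP.
have [|||s' [e1 m1 t1 _]] := @exec_loop_free c s (bitlen B) lf (bitlen_gt0 _).
- by move=> u v; apply: leq_bitlen.
- by move=> u v; apply: leq_bitlen.
- exact: bounded_bits (hB _ _ hP).
exists s'; split=> //; first by have := hQ _ _ hP; rewrite -m1.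
by apply: leq_trans t1 _; rewrite leq_add2l leq_mul2l leq_pmulr ?orbT.
Qed.

Lemma triple_seq P Q R c1 c2 : triple P c1 Q -> triple Q c2 R -> triple P (Seq c1 c2) R.
Proof.
move=> h1 h2 s hP; have [s1 [e1 q1 t1]] := h1 s hP.
have [s2 [e2 q2 t2]] := h2 s1 q1.
exists s2; split=> //; first exact: exec_seq e1 e2.
apply: leq_trans t2 _ => /=; have := grow_gt0 c1; nia.
Qed.

Lemma triple_conseq P P' Q Q' c : (forall m k, P' m k -> P m k) ->
  (forall m k, Q m k -> Q' m k) -> triple P c Q -> triple P' c Q'.
Proof.
move=> hP hQ h s hs; have [s' [e1 q1 t1]] := h s (hP _ _ hs).
by exists s'; split=> //; apply: hQ.
Qed.

Lemma triple_if P Q x c1 c2 : (forall m k, P m k -> bounded B m) ->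
  triple (fun m k => P m k /\ eval m x != 0) c1 Q ->
  triple (fun m k => P m k /\ eval m x = 0) c2 Q -> triple P (If x c1 c2) Q.
Proof.
move=> hB h1 h2 s hP.
have cx := cost_le x (bitlen_gt0 _) (bounded_bits (hB _ _ hP)).
have cF : ecost x * bitlen B <= ecost x * (bitlen B * F).
  by rewrite leq_mul2l leq_pmulr ?orbT.
have LF : 0 < bitlen B * F by rewrite muln_gt0 F0.
have := @exec_if pq nq w x c1 c2 s => /=.
case: ifP => [ex|/negbT]; last rewrite negbK => /eqP ex.
- move=> ei; have [s1 [e1 q1 t1]] := h1 (charge (cost (st_mem s) x).+1 s) (conj hP ex).
  by exists s1; split=> //; [exact: ei | move: t1 => /=; nia].
- move=> ei; have [s1 [e1 q1 t1]] := h2 (charge (cost (st_mem s) x).+1 s) (conj hP ex).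
  by exists s1; split=> //; [exact: ei | move: t1 => /=; nia].
Qed.

(** The invariant carries its own potential [f] and restores the bound [B] at every iteration, so
    the growth [grow] of the body never compounds. *)
Lemma triple_while (I : nat -> memory -> nat -> Prop) x c : loop_free c ->
  (forall f m k, I f m k -> bounded B m) ->
  (forall f m k, I f m k -> eval m x != 0 ->
     exists2 f', f' < f & I f' (step c (m, k)).1 (step c (m, k)).2) ->
  triple (fun m k => exists2 f, f <= F & I f m k) (While x c)
         (fun m k => exists2 f, I f m k & eval m x = 0).
Proof.
move=> lf hB hI s [f fF hf].
suff [s' [e1 q1 t1]] : exists s', [/\ exec pq nq w (While x c) s s',
    exists2 f', I f' (st_mem s') (st_coins s') & eval (st_mem s') x = 0
    & st_time s' <= st_time s + (ecost x + 1 + kost c) * (bitlen B * f.+1)].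
  exists s'; split=> //; apply: leq_trans t1 _ => /=; rewrite leq_add2l.
  (* Potential [f] allows at most [f + 1] tests of the guard, and [f + 1 <= 2 * F] because [F > 0]:
     this is the 2 in the [While] case of [kost]. *)
  rewrite (mulnC 2) -!mulnA leq_mul2l; apply/orP; right; nia.
elim/ltn_ind: f s {fF} hf => f IH s hf.
have cx := cost_le x (bitlen_gt0 _) (bounded_bits (hB _ _ _ hf)).
have L0 := bitlen_gt0 B.
have [ex|ex] := eqVneq (eval (st_mem s) x) 0.
  exists (charge (cost (st_mem s) x).+1 s); split; [exact: exec_while_stop | by exists f |].
  by rewrite /=; nia.
have [f' ff' hf'] := hI _ _ _ hf ex.
have [|||s1 [e1 m1 t1 _]] := @exec_loop_free c (charge (cost (st_mem s) x).+1 s) (bitlen B) lf L0.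
- by move=> u v; apply: leq_bitlen.
- by move=> u v; apply: leq_bitlen.
- exact: bounded_bits (hB _ _ _ hf).
have [|s' [e2 q2 t2]] := IH f' ff' s1; first by move: hf'; rewrite -m1.
exists s'; split=> //; first by apply: exec_while_step e1 e2; apply/eqP.
apply: leq_trans t2 _; move: t1 => /= t1.
have : (ecost x + 1 + kost c) * (bitlen B * f'.+1) + (ecost x + 1 + kost c) * bitlen B
   <= (ecost x + 1 + kost c) * (bitlen B * f.+1).
  by rewrite -mulnDr leq_mul2l -mulnSr leq_mul2l; apply/orP; right; apply/orP; right.
nia.
Qed.

End Logic.

(** * Space and queries bounded by time *)

Lemma memory_size_update m cells a i v :
  memory_size (update m a i v) ((a, i) :: cells)
  <= bitlen i + bitlen v + memory_size m cells.
Proof.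
rewrite /memory_size /=.
have eqf p : p != (a, i) -> update m a i v p.1 p.2 = m p.1 p.2.
  by case: p => b j; rewrite /update xpair_eqE /= => /negbTE ->.
have atai : update m a i v a i = v by rewrite /update !eqxx.
case: ifPn => hin.
  rewrite -mem_undup in hin.
  rewrite (bigD1_seq _ hin) ?undup_uniq //= (bigD1_seq _ hin (undup_uniq _)) /=.
  rewrite atai (eq_bigr (fun p => bitlen p.2 + bitlen (m p.1 p.2))) => [|p /eqf ->//].
  by lia.
rewrite big_cons /= atai leq_add2l.
rewrite big_seq_cond [X in _ <= X]big_seq_cond leq_sum // => p /andP[hp _].
rewrite eqf //; apply: contraNneq hin => <-; by rewrite -mem_undup.
Qed.

(** A store is charged [1 + bitlen i + bitlen v]: the bit lengths pay for the growth of the memory,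
    the 1 for the query that may come with it. [K] stands for the size of the initial memory. *)
Lemma exec_resources pq nq w c s s' K : exec pq nq w c s s' ->
  [/\ memory_size (st_mem s) (st_cells s) <= K + st_time s,
      st_space s <= K + st_time s & st_queries s <= st_time s] ->
  [/\ memory_size (st_mem s') (st_cells s') <= K + st_time s',
      st_space s' <= K + st_time s' & st_queries s' <= st_time s'].
Proof.
have st a i v t q k s0 : q <= t.+1 ->
    [/\ memory_size (st_mem s0) (st_cells s0) <= K + st_time s0,
      st_space s0 <= K + st_time s0 & st_queries s0 <= st_time s0] ->
    let s1 := store a i v (State (st_mem s0) (st_cells s0) k (st_queries s0 + q)
       (st_time s0 + t) (st_space s0)) in
    [/\ memory_size (st_mem s1) (st_cells s1) <= K + st_time s1,
      st_space s1 <= K + st_time s1 & st_queries s1 <= st_time s1].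
  move=> qt [h1 h2 h3] /=; have := memory_size_update (st_mem s0) (st_cells s0) a i v.
  by move=> h; split; rewrite ?geq_max; [lia | apply/andP; split; lia | lia].
have ch t s0 : [/\ memory_size (st_mem s0) (st_cells s0) <= K + st_time s0,
      st_space s0 <= K + st_time s0 & st_queries s0 <= st_time s0] ->
    [/\ memory_size (st_mem s0) (st_cells s0) <= K + (st_time s0 + t),
      st_space s0 <= K + (st_time s0 + t) & st_queries s0 <= st_time s0 + t].
  by move=> [h1 h2 h3]; split; lia.
elim=> {c s s'}.
- by move=> s h; apply: ch.
- move=> a i x s m h;
  have := st a (eval m i) (eval m x) (cost m i + cost m x) 0 (st_coins s) s isT h.
  by rewrite addn0.
- by move=> c1 c2 s s1 s2 _ h1 _ h2 /h1/h2.
- by move=> x c1 c2 s s1 m _ h1 h; apply: h1; apply: ch.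
- by move=> x c s m _ h; apply: ch.
- by move=> x c s s1 s2 m _ _ h1 _ h2 h; apply/h2/h1/ch.
- move=> a s h; have := st a 0 (w (st_coins s)) 0 0 (st_coins s).+1 s isT h.
  by rewrite !addn0.
- move=> a x y s m h.
  have := st a 0 (pq (eval m x) (eval m y)) (cost m x + cost m y
                       + bitlen (eval m x) + bitlen (eval m y)) 1 (st_coins s) s isT h.
  by rewrite addn1.
- move=> a x y s m h.
  have := st a 0 (nq (eval m x) (eval m y)) (cost m x + cost m y
                       + bitlen (eval m x) + bitlen (eval m y)) 1 (st_coins s) s isT h.
  by rewrite addn1.
Qed.

(** * Framing *)

Fixpoint writes (c : cmd) : seq nat :=
  match c with
  | Skip => [::]
  | Assign a _ _ | Flip a | AskPair a _ _ | AskNbr a _ _ => [:: a]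
  | Seq c1 c2 | If _ c1 c2 => writes c1 ++ writes c2
  | While _ c => writes c
  end.

Lemma exec_frame pq nq w c s s' a i : exec pq nq w c s s' ->
  a \notin writes c -> st_mem s' a i = st_mem s a i.
Proof.
have up m b j v : a \notin [:: b] -> update m b j v a i = m a i.
  by rewrite inE /update => /negbTE ->.
elim=> {c s s'} //=.
- by move=> b j x s; apply: up.
- by move=> c1 c2 s s1 s2 _ h1 _ h2; rewrite mem_cat negb_or => /andP[/h1 <- /h2].
- by move=> x c1 c2 s s1; case: ifP => _ _ h; rewrite mem_cat negb_or => /andP[h1 h2]; apply: h.
- by move=> x c s s1 s2 _ _ h1 _ h2 ha; rewrite h2 // h1.
- by move=> b s; apply: up.
- by move=> b x y s; apply: up.
- by move=> b x y s; apply: up.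
Qed.

(** Lets each loop specification speak only of the arrays that it uses; the rest is carried past the
    loop in [Phi]. *)
Lemma triple_frame pq nq w B F (P Q : memory -> nat -> Prop) c (Phi : memory -> Prop) :
  (forall m m', (forall a, a \notin writes c -> forall i, m' a i = m a i) ->
     Phi m -> Phi m') ->
  triple pq nq w B F P c Q ->
  triple pq nq w B F (fun m k => P m k /\ Phi m) c (fun m k => Q m k /\ Phi m).
Proof.
move=> hPhi h s [hP hs]; have [s' [e1 q1 t1]] := h s hP.
exists s'; split=> //; split=> //; apply: hPhi hs => a ha i.
exact: exec_frame e1 ha.
Qed.

(** * The coloring program *)

(* Scalars and arrays of the program. [aStart] and [aTo] store adjacency lists
   contiguously; the entries of [aBkt] at the cells [bucket_cell d] form a stack of
   height [aHt d] of vertices whose degree is at most [d]; [aRem] is the position of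
   a vertex in the elimination order [aOrd], or 0 if it is still present. *)
Local Notation aN := 0.
Local Notation aOut := 1.
Local Notation aQ := 2.
Local Notation aL := 3.
Local Notation aM := 4.
Local Notation aGam := 5.
Local Notation aU := 6.
Local Notation aP := 7.
Local Notation aT := 8.
Local Notation aStart := 9.
Local Notation aTo := 10.
Local Notation aI := 11.
Local Notation aShift := 12.
Local Notation aG := 13.
Local Notation aBlk := 14.
Local Notation aV := 15.
Local Notation aDeg := 16.
Local Notation aHt := 17.
Local Notation aBkt := 18.
Local Notation aK := 19.
Local Notation aCnt := 20.
Local Notation aEnd := 21.
Local Notation aX := 22.
Local Notation aRem := 23.
Local Notation aOrd := 24.
Local Notation aD := 25.
Local Notation aC := 26.
Local Notation aCol := 27.
Local Notation aMark := 28.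

Local Notation sc a := (Get a (Const 0)).
Local Notation put a x := (Assign a (Const 0) x).
Local Notation add := (Op Add).
Local Notation sub := (Op Sub).
Local Notation mul := (Op Mul).
Local Notation quo := (Op Div).
Local Notation rem x y := (Op Sub x (Op Mul (Op Div x y) y)).
Local Notation lt := (Op Lt).
Local Notation one := (Const 1).
Local Notation "c1 ;; c2" := (Seq c1 c2) (at level 60, right associativity).

Definition tau_expr (E : nat) (q l : expr) : expr :=
  mul (mul (Const E) (mul (mul q q) q)) l.

(** Tests the candidate [q + 1] with [2 * l]; squaring [tau] avoids a square root of [n]. *)
Definition setup_guard (E : nat) : expr :=
  let x := tau_expr E (add (sc aQ) one) (mul (sc aL) (Const 2)) in
  Op Eq (lt (sc aN) (mul x x)) (Const 0).

Definition setup_body : cmd :=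
  put aQ (add (sc aQ) one) ;; put aL (mul (sc aL) (Const 2)).

Definition params (E : nat) : cmd :=
  put aM (mul (mul (Const 2) (sc aN)) (tau_expr E (sc aQ) (sc aL))) ;;
  put aGam (add (quo (sc aN) (sc aL)) one) ;;
  put aU one.

Definition read_guard : expr :=
  mul (lt (sc aU) (add (sc aN) one)) (lt (sc aP) (sc aM)).

Definition read_body : cmd :=
  AskNbr aT (sc aU) (add (sub (sc aP) (Get aStart (sc aU))) one) ;;
  If (sc aT)
    (Assign aTo (sc aP) (sc aT) ;; put aP (add (sc aP) one))
    (put aU (add (sc aU) one) ;; Assign aStart (sc aU) (sc aP)).

Definition toss_guard : expr := lt (sc aI) (mul (sc aGam) (sc aQ)).

Definition toss_body : cmd :=
  Flip aT ;;
  Assign aShift (quo (sc aI) (sc aQ))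
    (add (mul (Const 2) (Get aShift (quo (sc aI) (sc aQ)))) (sc aT)) ;;
  put aI (add (sc aI) one).

Definition pair_guard : expr := lt (sc aU) (add (sc aN) one).

(** The double loop over vertices and groups is flattened to keep the body loop-free: the value
    [gam] of [aG] means moving on to the next vertex. *)
Definition pair_body : cmd :=
  If (lt (sc aG) (sc aGam))
    (Assign aBlk (sc aU)
       (rem (sub (add (rem (sub (sc aU) one) (sc aL)) (sc aL))
                 (Get aShift (quo (sub (sc aU) one) (sc aL)))) (sc aL)) ;;
     put aV (add (add (mul (sc aG) (sc aL))
                      (rem (add (Get aBlk (sc aU)) (Get aShift (sc aG))) (sc aL)))
                 one) ;;
     AskPair aT (sc aU) (sc aV) ;;
     If (sc aT)
       (Assign aTo (sc aP) (sc aV) ;; put aP (add (sc aP) one))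
       Skip ;;
     put aG (add (sc aG) one))
    (put aU (add (sc aU) one) ;; Assign aStart (sc aU) (sc aP) ;; put aG (Const 0)).

Definition fill_guard : expr := lt (sc aV) (add (sc aN) one).

Definition bucket_cell (d : expr) : expr :=
  add (mul (Get aHt d) (add (sc aN) one)) d.

Definition fill_body : cmd :=
  put aD (sub (Get aStart (add (sc aV) one)) (Get aStart (sc aV))) ;;
  Assign aDeg (sc aV) (sc aD) ;;
  Assign aBkt (bucket_cell (sc aD)) (sc aV) ;;
  Assign aHt (sc aD) (add (Get aHt (sc aD)) one) ;;
  put aV (add (sc aV) one).

Definition peel_guard : expr := lt (sc aCnt) (sc aN).

(** One flat loop with three kinds of iteration: scan a pending arc of the vertex just removed, pop
    an entry of bucket [aK], or raise [aK] when that bucket is empty. Entries of vertices already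
    removed are dropped when popped. *)
Definition peel_body : cmd :=
  If (lt (sc aP) (sc aEnd))
    (put aX (Get aTo (sc aP)) ;; put aP (add (sc aP) one) ;;
     If (Get aRem (sc aX)) Skip
       (Assign aDeg (sc aX) (sub (Get aDeg (sc aX)) one) ;;
        put aD (add (Get aDeg (sc aX)) (sub (sc aK) (Get aDeg (sc aX)))) ;;
        Assign aBkt (bucket_cell (sc aD)) (sc aX) ;;
        Assign aHt (sc aD) (add (Get aHt (sc aD)) one)))
    (If (Get aHt (sc aK))
       (Assign aHt (sc aK) (sub (Get aHt (sc aK)) one) ;;
        put aV (Get aBkt (bucket_cell (sc aK))) ;;
        If (Get aRem (sc aV)) Skip
          (Assign aOrd (sc aCnt) (sc aV) ;;
           put aCnt (add (sc aCnt) one) ;;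
           Assign aRem (sc aV) (sc aCnt) ;;
           put aP (Get aStart (sc aV)) ;;
           put aEnd (Get aStart (add (sc aV) one))))
       (put aK (add (sc aK) one))).

Definition load : cmd :=
  put aV (Get aOrd (sub (sc aI) one)) ;;
  put aP (Get aStart (sc aV)) ;;
  put aEnd (Get aStart (add (sc aV) one)) ;;
  put aC one.

Definition color_body : cmd :=
  If (lt (sc aP) (sc aEnd))
    (Assign aMark (Get aCol (Get aTo (sc aP))) (sc aV) ;; put aP (add (sc aP) one))
    (If (Op Eq (Get aMark (sc aC)) (sc aV))
       (put aC (add (sc aC) one))
       (Assign aCol (sc aV) (sc aC) ;;
        Assign aOut (sc aV)
          (add (mul (sub (sc aC) one) (sc aL)) (Get aBlk (sc aV))) ;;
        put aI (sub (sc aI) one) ;;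
        load)).

Definition random_part : cmd :=
  While toss_guard toss_body ;;
  (put aU one ;; put aP (Const 0)) ;;
  While pair_guard pair_body.

Definition coloring_part : cmd :=
  put aV one ;;
  While fill_guard fill_body ;;
  While peel_guard peel_body ;;
  (put aI (sc aN) ;; load) ;;
  While (sc aI) color_body.

Definition coloring_prog (E : nat) : cmd :=
  put aL one ;;
  While (setup_guard E) setup_body ;;
  params E ;;
  While read_guard read_body ;;
  If (lt (sc aU) (add (sc aN) one)) random_part (put aL one) ;;
  coloring_part.

(** * Acquiring the graph *)

(* [acquired N u s m]: the lists [N y] with [y < u] and the prefix [s] of [N u]
   are stored contiguously in memory. *)
Definition acquired (N : nat -> seq nat) (u : nat) (s : seq nat) (m : memory) : Prop :=
  [/\ 0 < u,
      forall y, 0 < y <= u -> m aStart y = \sum_(1 <= z < y) size (N z),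
      m aP 0 = \sum_(1 <= z < u) size (N z) + size s,
      forall y j, 0 < y < u -> j < size (N y) ->
        m aTo (m aStart y + j) = nth 0 (N y) j
    & forall j, j < size s -> m aTo (m aStart u + j) = nth 0 s j].

Lemma sum_size_rcons (N : nat -> seq nat) y : 0 < y ->
  \sum_(1 <= z < y.+1) size (N z) = \sum_(1 <= z < y) size (N z) + size (N y).
Proof. by move=> y0; rewrite big_nat_recr. Qed.

Lemma sum_size_mono (N : nat -> seq nat) x y : x <= y ->
  \sum_(1 <= z < x) size (N z) <= \sum_(1 <= z < y) size (N z).
Proof.
move=> xy; case: (posnP x) => [->|x0]; first by rewrite big_geq.
by rewrite (@big_cat_nat _ _ addn x 1 y) //= leq_addr.
Qed.

Lemma acquired_push N u s m m' v : acquired N u s m ->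
  m' aStart =1 m aStart ->
  (forall j, m' aTo j = if j == m aP 0 then v else m aTo j) ->
  m' aP 0 = (m aP 0).+1 -> acquired N u (rcons s v) m'.
Proof.
move=> [u0 hS hP hT hs] eS eT eP; split=> //.
- by move=> y hy; rewrite eS hS.
- by rewrite eP hP size_rcons addnS.
- move=> y j hy hj; rewrite eS eT hT //; case: eqP => // h.
  have hu : 0 < y <= u by lia.
  have /(sum_size_mono N) : y.+1 <= u by lia.
  rewrite sum_size_rcons; last by lia.
  by move: h; rewrite hS // hP; lia.
- have hu : 0 < u <= u by lia.
  move=> j; rewrite size_rcons nth_rcons ltnS eS eT hP hS // eqn_add2l => hj.
  by case: ltngtP hj => // hj _; rewrite -hs // hS.
Qed.

Lemma acquired_next N u m m' : acquired N u (N u) m ->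
  (forall j, m' aStart j = if j == u.+1 then m aP 0 else m aStart j) ->
  m' aTo =1 m aTo -> m' aP 0 = m aP 0 -> acquired N u.+1 [::] m'.
Proof.
move=> [u0 hS hP hT hs] eS eT eP; split=> //.
- move=> y hy; rewrite eS; case: eqP => [->|h]; first by rewrite sum_size_rcons.
  by apply: hS; lia.
- by rewrite eP hP sum_size_rcons ?addn0.
- move=> y j hy hj; rewrite eS eT; case: eqP => [h|_]; first by lia.
  case: (eqVneq y u) hj => [->|hu] hj; first exact: hs.
  by apply: hT => //; lia.
Qed.

Lemma mulb_neq0 (a b : bool) : (a * b != 0) = a && b.
Proof. by case: a; case: b. Qed.

(** * Reading adjacency lists within the budget *)

Section ReadLoop.
Variables (pq nq : nat -> nat -> nat) (w : nat -> bool) (B F n M : nat).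
Variable N : nat -> seq nat.
Hypotheses (F0 : 0 < F) (pqB : forall u v, pq u v <= B) (nqB : forall u v, nq u v <= B).
Hypotheses (nB : n < B) (MB : M <= B) (MF : M + n <= F).
Hypothesis N_nq : forall u j, 0 < u <= n -> nq u j.+1 = nth 0 (N u) j.
Hypothesis N_pos : forall u, 0 \notin N u.

(** Each iteration either stores a neighbor or advances to the next vertex, whence the potential. *)
Definition read_inv (f : nat) (m : memory) (k : nat) : Prop :=
  [/\ bounded B m, m aN 0 = n, m aM 0 = M, k = 0 &
    exists2 j, [/\ j <= size (N (m aU 0)), m aP 0 <= M, m aU 0 <= n.+1
                 & m aU 0 = n.+1 -> j = 0]
      & acquired N (m aU 0) (take j (N (m aU 0))) m
        /\ f = (M - m aP 0) + (n.+1 - m aU 0)].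

Lemma read_step f m k : read_inv f m k -> eval m read_guard != 0 ->
  exists2 f', f' < f & read_inv f' (step pq nq w read_body (m, k)).1
                                   (step pq nq w read_body (m, k)).2.
Proof.
move=> [hB hN hM hk [i [hi hPM hU hUi] [hacq hf]]].
rewrite /= hN hM mulb_neq0 addn1 !ltnS => /andP[hUn hPM'].
have [u0 hS hP hT hs] := hacq.
have hn : 0 < m aU 0 <= n by rewrite u0.
have hj : m aP 0 - m aStart (m aU 0) = i.
  by rewrite hS ?u0 ?leqnn // hP addKn size_takel.
rewrite /update /= addn1 N_nq // hj.
have tB : nth 0 (N (m aU 0)) i <= B by rewrite -N_nq.
have iN : nth 0 (N (m aU 0)) i != 0 -> i < size (N (m aU 0)).
  by apply: contraR; rewrite -leqNgt => /(nth_default 0) ->.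
case: ifP => [/iN {}iN|/negbT/negPn/eqP t0] /=.
  exists (M - (m aP 0).+1 + (n.+1 - m aU 0)); first by lia.
  split=> //=; first by move=> a x /=; do !case: ifP => _ //; lia.
  rewrite !addn1; exists i.+1; first by split; lia.
  split=> //; rewrite (take_nth 0) //.
  by apply: acquired_push hacq _ _ _.
(* The answer 0 is no vertex name, so it can only mark the end of the list. *)
have iE : i = size (N (m aU 0)).
  apply/eqP; rewrite eqn_leq hi leqNgt; apply/negP => h.
  by have := mem_nth 0 h; rewrite t0; apply/negP.
exists (M - m aP 0 + (n.+1 - (m aU 0).+1)); first by lia.
split=> //=; first by move=> a x /=; do !case: ifP => _ //; lia.
rewrite !addn1; exists 0; first by split; lia.
split=> //; rewrite take0; apply: (@acquired_next _ _ m) => //.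
by move: hacq; rewrite iE take_size.
Qed.

(** If the loop stops at a vertex [u <= n], the budget is used up, and the stored entries all belong
    to the lists of [1, ..., n]: this is the certificate of density. *)
Lemma read_loop :
  triple pq nq w B F
    (fun m k => [/\ bounded B m, m aN 0 = n, m aM 0 = M, k = 0 &
       [/\ m aU 0 = 1, m aP 0 = 0 & m aStart 1 = 0]])
    (While read_guard read_body)
    (fun m k => [/\ bounded B m, k = 0 &
       (m aU 0 = n.+1 /\ acquired N n.+1 [::] m /\ m aP 0 <= M) \/
       [/\ m aU 0 <= n, m aStart 1 = 0 & M <= \sum_(1 <= z < n.+1) size (N z)]]).
Proof.
apply: triple_conseq (triple_while F0 pqB nqB (I := read_inv) _ _ _) => //.
- move=> m k [hB hN hM hk [hU hP hS]].
  exists (M - m aP 0 + (n.+1 - m aU 0)); first by lia.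
  split=> //; rewrite hU; exists 0; first by split; lia.
  rewrite take0; split=> //; split=> //.
  + by move=> y hy; have -> : y = 1 by [lia]; rewrite big_geq.
  + by rewrite hP big_geq.
  + by move=> y j; lia.
- move=> m k [f [hB hN hM hk [i [hi hPM hU hUi] [hacq hf]]]].
  rewrite /= hN hM addn1 => h; split=> //.
  have [hUn|hUn] := ltnP (m aU 0) n.+1; last first.
    have e : m aU 0 = n.+1 by lia.
    by left; split=> //; split=> //; move: hacq; rewrite (hUi e) take0 e.
  case: hacq => u0 hS hP _ _; right; split=> //.
    by rewrite hS ?u0 // big_geq.
  move: h; rewrite hUn mul1n; case: ltnP => // hMP _.
  apply: leq_trans hMP _; rewrite hP size_takel //.
  apply: (leq_trans (n := \sum_(1 <= z < (m aU 0).+1) size (N z))).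
    by rewrite sum_size_rcons // leq_add2l.
  exact: sum_size_mono.
- by move=> f m k [].
- exact: read_step.
Qed.

End ReadLoop.

(** * The parameters [q] and [tau] *)

(* [tau D q] is the degeneracy above which shifting groups of [2 ^ q] vertices works;
   [qlog D n] is the largest [q] with [tau D q <= sqrt n]. *)
Definition tau (D q : nat) : nat := 2 ^ D * (q * q * q) * 2 ^ q.

Lemma tau_unbounded D n : exists q, n < tau D q.+1 ^ 2.
Proof.
exists n; have h : n < tau D n.+1.
  have := ltn_expl n.+1 (isT : 1 < 2); have := expn_gt0 2 D; rewrite /tau; nia.
nia.
Qed.

Definition qlog (D n : nat) : nat := ex_minn (tau_unbounded D n).

Section Qlog.
Variables (D n : nat).

Lemma qlog_min q : n < tau D q.+1 ^ 2 -> qlog D n <= q.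
Proof. by move=> h; rewrite /qlog; case: ex_minnP => k _ kmin; apply: kmin. Qed.

Lemma ltn_tau_qlog : n < tau D (qlog D n).+1 ^ 2.
Proof. by rewrite /qlog; case: ex_minnP. Qed.

Lemma tau_qlog_leq : tau D (qlog D n) ^ 2 <= n.
Proof.
(* The factor [q ^ 3] makes [tau D 0 = 0], so [q = 0] is always admissible. *)
case e: (qlog D n) => [|q]; first by rewrite /tau !(muln0, mul0n).
rewrite leqNgt; apply/negP => /qlog_min; rewrite e; lia.
Qed.

Lemma exp2_qlog_leq_pos : 0 < n -> 2 ^ qlog D n <= n.
Proof.
case e: (qlog D n) => [|q] //; have := tau_qlog_leq; rewrite e /tau => h _.
apply: leq_trans h; set x := 2 ^ q.+1.
have x0 : 0 < x by rewrite expn_gt0.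
have h1 : 1 <= 2 ^ D * (q.+1 * q.+1 * q.+1) by rewrite muln_gt0 expn_gt0.
move: (2 ^ D * _) h1 => y h1; rewrite -mulnn.
by apply: leq_trans (leq_pmull x h1) _; rewrite leq_pmull // muln_gt0 h1.
Qed.

Lemma exp2_qlog_leq : 2 ^ qlog D n <= n.+1.
Proof.
case: (posnP n) => [n0|/exp2_qlog_leq_pos]; last exact: leqW.
by have := tau_qlog_leq; rewrite n0; case: (qlog D 0) => // q;
  rewrite leqn0 expn_eq0 /tau !muln_eq0 !expn_eq0.
Qed.

Lemma qlog_leq : qlog D n <= n.
Proof. have := exp2_qlog_leq; have := ltn_expl (qlog D n) (isT : 1 < 2); lia. Qed.

End Qlog.

Lemma qlog_ge D q n : tau D q ^ 2 <= n -> q <= qlog D n.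
Proof.
move=> h; rewrite leqNgt; apply/negP => lt; have := ltn_tau_qlog D n.
rewrite ltnNge (leq_trans _ h) // leq_exp2r // /tau leq_mul ?leq_exp2l //.
by rewrite leq_mul2l !leq_mul ?orbT.
Qed.

Lemma qlog_mono D m n : m <= n -> qlog D m <= qlog D n.
Proof. by move=> h; apply: qlog_min; apply: leq_ltn_trans h (ltn_tau_qlog _ _). Qed.

Section SetupLoop.
Variables (pq nq : nat -> nat -> nat) (w : nat -> bool) (B F n D : nat).
Hypotheses (F0 : 0 < F) (pqB : forall u v, pq u v <= B) (nqB : forall u v, nq u v <= B).
Hypotheses (nB : n < B) (nF : n <= F).

Lemma setup_loop :
  triple pq nq w B F
    (fun m k => [/\ bounded B m, m aN 0 = n, m aQ 0 = 0, m aL 0 = 1 & k = 0])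
    (While (setup_guard (2 ^ D)) setup_body)
    (fun m k => [/\ bounded B m, m aQ 0 = qlog D n, m aL 0 = 2 ^ qlog D n & k = 0]).
Proof.
pose I f (m : memory) (k : nat) := [/\ bounded B m, m aN 0 = n /\ k = 0,
  m aQ 0 <= qlog D n, m aL 0 = 2 ^ m aQ 0 & f = qlog D n - m aQ 0].
have gE (m : memory) : m aN 0 = n -> m aL 0 = 2 ^ m aQ 0 ->
    eval m (setup_guard (2 ^ D)) = ~~ (n < tau D (m aQ 0).+1 ^ 2).
  by move=> hN hL; rewrite /= hN hL /tau -mulnn (expnS 2 (m aQ 0)) addn1 (mulnC 2); case: (_ < _).
have qn := qlog_leq D n; have ln := exp2_qlog_leq D n.
apply: triple_conseq (triple_while F0 pqB nqB (I := I) _ _ _) => //.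
- move=> m k [hB hN hQ hL hk]; exists (qlog D n); first by lia.
  by split=> //; rewrite ?hQ ?hL // subn0.
- move=> m k [f [hB [hN hk] hQ hL hf]]; rewrite gE //; case: ltnP => // h _.
  have eQ : m aQ 0 = qlog D n by apply/eqP; rewrite eqn_leq hQ qlog_min.
  by split=> //; rewrite hL eQ.
- by move=> f m k [].
- move=> f m k [hB [hN hk] hQ hL hf]; rewrite gE //; case: ltnP => // h _.
  have lq : m aQ 0 < qlog D n.
    rewrite ltn_neqAle hQ andbT; apply/eqP => e.
    by have := ltn_tau_qlog D n; rewrite -e; lia.
  exists (qlog D n - (m aQ 0).+1); first by lia.
  have le2 : 2 ^ (m aQ 0).+1 <= 2 ^ qlog D n by rewrite leq_exp2l.
  rewrite /I /= /update /= hL !addn1 (mulnC _ 2) -expnS.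
  split=> //=; first by move=> a i /=; do !case: ifP => _ //; lia.
Qed.

End SetupLoop.

(** * Drawing the shifts *)

Fixpoint coin_val (w : nat -> bool) (s j : nat) : nat :=
  if j is j'.+1 then 2 * coin_val w s j' + w (s + j') else 0.

Lemma coin_val_lt w s j : coin_val w s j < 2 ^ j.
Proof. by elim: j => //= j; rewrite expnS; case: (w _); lia. Qed.

Section TossLoop.
Variables (pq nq : nat -> nat -> nat) (w : nat -> bool) (B F q gam : nat).
Hypotheses (F0 : 0 < F) (pqB : forall u v, pq u v <= B) (nqB : forall u v, nq u v <= B).
Hypotheses (qB : 2 ^ q <= B) (gqB : gam * q <= B) (gqF : gam * q <= F).

Lemma toss_loop :
  triple pq nq w B F
    (fun m k => [/\ bounded B m, m aQ 0 = q, m aGam 0 = gam, k = 0 &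
       m aI 0 = 0 /\ forall g, m aShift g = 0])
    (While toss_guard toss_body)
    (fun m k => bounded B m /\
       forall g, g < gam -> m aShift g = coin_val w (g * q) q).
Proof.
(* With truncated subtraction, [minn q (k - g * q)] is [q] for a finished group, the number of coins
   used so far for the current one, and 0 for an untouched one. *)
pose I f (m : memory) (k : nat) := [/\ bounded B m, m aQ 0 = q, m aGam 0 = gam,
  k = m aI 0 & [/\ k <= gam * q, f = gam * q - k &
  forall g, m aShift g = coin_val w (g * q) (minn q (k - g * q))]].
apply: triple_conseq (triple_while F0 pqB nqB (I := I) _ _ _) => //.
- move=> m k [hB hQ hG hk [hI hS]]; exists (gam * q) => //.
  split=> //; rewrite hk ?hI //; split; rewrite ?subn0 //.
- move=> m k [f [hB hQ hG hk [hk2 hf hS]]]; rewrite /= hQ hG -hk.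
  case: ltnP => // h _; split=> // g hg; rewrite hS.
  have -> : k = gam * q by lia.
  by congr coin_val; apply/minn_idPl; rewrite -mulnBl leq_pmull // subn_gt0.
- by move=> f m k [].
- move=> f m k [hB hQ hG hk [hk2 hf hS]]; rewrite /= hQ hG -hk => h.
  have {}h : k < gam * q by move: h; case: ltnP.
  have q0 : 0 < q by lia.
  exists (gam * q - k.+1); first by lia.
  rewrite /I /= /update /= hQ -hk.
  have ek := divn_eq k q; have lk := ltn_pmod k q0.
  have cE : 2 * m aShift (k %/ q) + w k = coin_val w (k %/ q * q) (k %% q).+1.
    rewrite hS /= -ek; congr (2 * coin_val _ _ _ + _).
    have -> : k - k %/ q * q = k %% q by lia.
    by apply/minn_idPr/ltnW.
  rewrite cE; split=> //=; last 2 first.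
  + by rewrite addn1.
  + split=> // g; case: eqP => [->|ng].
      have -> : k.+1 - k %/ q * q = (k %% q).+1 by lia.
      by rewrite (minn_idPr lk).
    rewrite hS; congr coin_val.
    have [hg|hg] := ltnP g (k %/ q).
      have : g.+1 * q <= k %/ q * q by rewrite leq_mul2r hg orbT.
      rewrite mulSn => hq; rewrite !(minn_idPl _) //; lia.
    have hg' : k %/ q < g by lia.
    have : (k %/ q).+1 * q <= g * q by rewrite leq_mul2r hg' orbT.
    rewrite mulSn => hq.
    have -> : k - g * q = 0 by lia.
    by have -> : k.+1 - g * q = 0 by lia.
  + move=> a i /=; do !case: ifP => _ //; [lia | | by case: (w k); lia].
    have := coin_val_lt w (k %/ q * q) (k %% q).+1.
    have : 2 ^ (k %% q).+1 <= 2 ^ q by rewrite leq_exp2l.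
    by rewrite /=; lia.
Qed.

End TossLoop.

(** * Querying the pairs inside blocks *)

Lemma sub_divn_mul x l : x - x %/ l * l = x %% l.
Proof. by rewrite {1}(divn_eq x l) addKn. Qed.

(** Vertex [u] has offset [(u - 1) %% l] in group [(u - 1) %/ l]; its block is the offset minus the
    shift, mod [l]. The added [l] keeps the subtraction from being truncated. *)
Definition blk (sh : nat -> nat) (l u : nat) : nat :=
  ((u - 1) %% l + l - sh ((u - 1) %/ l)) %% l.

(** The only name of group [g] in the block of [u]. In the last group it may exceed [n], where a
    pair query answers 0. *)
Definition mate (sh : nat -> nat) (l u g : nat) : nat :=
  g * l + (blk sh l u + sh g) %% l + 1.

Definition mates (pq : nat -> nat -> nat) (sh : nat -> nat) (l u k : nat) : seq nat :=
  [seq x <- [seq mate sh l u g | g <- iota 0 k] | pq u x != 0].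

Lemma matesS pq sh l u k : mates pq sh l u k.+1 =
  if pq u (mate sh l u k) != 0 then rcons (mates pq sh l u k) (mate sh l u k)
  else mates pq sh l u k.
Proof.
rewrite /mates -addn1 iotaD map_cat filter_cat /= add0n.
by case: ifP; rewrite ?cats1 ?cats0.
Qed.

Section PairLoop.
Variables (pq nq : nat -> nat -> nat) (w : nat -> bool) (B F n l gam : nat).
Variable sh : nat -> nat.
Hypotheses (F0 : 0 < F) (pqB : forall u v, pq u v <= B) (nqB : forall u v, nq u v <= B).
Hypotheses (nB : n < B) (l0 : 0 < l) (lB : l <= B) (glB : gam * l <= B).
Hypotheses (ngB : n * gam <= B) (gB : gam <= B) (ngF : n * gam.+1 <= F) (g0 : 0 < gam).
Hypothesis grp : n < gam * l.

Let N u := mates pq sh l u gam.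

(** A vertex costs [gam] queries and one iteration to move on, hence the factor [gam.+1]. Its block
    is recorded along with its queries, so for the current vertex [aBlk] is known only once [aG] is
    positive. *)
Definition pair_inv (f : nat) (m : memory) (k : nat) : Prop :=
  [/\ bounded B m, [/\ m aN 0 = n, m aL 0 = l & m aGam 0 = gam],
    [/\ m aU 0 <= n.+1, m aG 0 <= gam & m aU 0 = n.+1 -> m aG 0 = 0],
    [/\ m aP 0 <= (m aU 0).-1 * gam + m aG 0,
      acquired N (m aU 0) (mates pq sh l (m aU 0) (m aG 0)) m &
      f = (n.+1 - m aU 0) * gam.+1 - m aG 0]
  & [/\ forall g, g < gam -> m aShift g = sh g &
    forall y, (0 < y < m aU 0) || (y == m aU 0) && (0 < m aG 0) -> m aBlk y = blk sh l y]].

Lemma pair_step f m k : pair_inv f m k -> eval m pair_guard != 0 ->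
  exists2 f', f' < f & pair_inv f' (step pq nq w pair_body (m, k)).1
                                   (step pq nq w pair_body (m, k)).2.
Proof.
move=> [hB [hN hL hG] [hU hg hUg] [hP hacq hf] [hS hb]].
rewrite /= hN hG addn1 => h; have {h} hUn : m aU 0 <= n by move: h; case: ltnP.
have [u0 _ _ _ _] := hacq.
have -> : ((m aG 0 < gam) : nat) != 0 = (m aG 0 < gam) by case: ltnP.
have f0 : (n.+1 - m aU 0) * gam.+1 = gam.+1 + (n - m aU 0) * gam.+1.
  by rewrite -mulSn subSn.
have leP : (m aU 0).-1 * gam + gam <= n * gam.
  have : (m aU 0).-1.+1 * gam <= n * gam by rewrite leq_mul2r; apply/orP; right; lia.
  by rewrite mulSn addnC.
have [hgg|hgg] := ltnP; last first.
  have eg : m aG 0 = gam by lia.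
  exists ((n.+1 - (m aU 0).+1) * gam.+1); first by rewrite hf f0 eg; lia.
  rewrite /update /= !addn1; split=> //=.
  - by move=> a x /=; do !case: ifP => _ //; lia.
  - split; rewrite ?subn0 //; last first.
      by apply: (@acquired_next _ _ m) => //; move: hacq; rewrite eg.
    by move: hP u0; rewrite eg; case: (m aU 0) => //= x; rewrite mulSn; lia.
  - split=> // y hy; apply: hb; rewrite eg; lia.
rewrite /update /= hL !sub_divn_mul !eqxx /=.
have gU : (m aU 0 - 1) %/ l < gam by rewrite ltn_divLR //; lia.
rewrite !hS // -/(blk sh l (m aU 0)) -/(mate sh l (m aU 0) (m aG 0)).
have bl : blk sh l (m aU 0) < l by rewrite ltn_mod.
have vl : mate sh l (m aU 0) (m aG 0) <= gam * l.
  have := ltn_pmod (blk sh l (m aU 0) + sh (m aG 0)) l0.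
  have : (m aG 0).+1 * l <= gam * l by rewrite leq_mul2r hgg orbT.
  by rewrite mulSn /mate; lia.
exists ((n.+1 - m aU 0) * gam.+1 - (m aG 0).+1).
  by rewrite hf f0; move: (_ * gam.+1) => z; lia.
have eM := matesS pq sh l (m aU 0) (m aG 0).
have pB := pqB (m aU 0) (mate sh l (m aU 0) (m aG 0)).
have hb' y : (0 < y < m aU 0) || (y == m aU 0) && (0 < (m aG 0).+1) ->
    (if y == m aU 0 then blk sh l (m aU 0) else m aBlk y) = blk sh l y.
  by case: eqP => [->//|ne]; rewrite andFb orbF => hy; apply: hb; rewrite hy.
case: ifP eM => hpq eM /=; rewrite !addn1.
- split=> //=.
  + by move=> a x /=; do !case: ifP => _ //; lia.
  + by split=> //; lia.
  + split=> //; first by lia.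
    by rewrite eM; apply: acquired_push hacq _ _ _.
- split=> //=.
  + by move=> a x /=; do !case: ifP => _ //; lia.
  + by split=> //; lia.
  + by split=> //; [lia | rewrite eM; case: hacq].
Qed.

Lemma pair_loop :
  triple pq nq w B F
    (fun m k => [/\ bounded B m, [/\ m aN 0 = n, m aL 0 = l & m aGam 0 = gam],
       [/\ m aU 0 = 1, m aP 0 = 0, m aG 0 = 0 & m aStart 1 = 0]
       & forall g, g < gam -> m aShift g = sh g])
    (While pair_guard pair_body)
    (fun m k => [/\ bounded B m, acquired N n.+1 [::] m, m aP 0 <= n * gam &
       forall y, 0 < y <= n -> m aBlk y = blk sh l y]).
Proof.
apply: triple_conseq (triple_while F0 pqB nqB (I := pair_inv) _ _ _) => //.
- move=> m k [hB hh [hU hP hG hS] hs]; exists (n * gam.+1) => //.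
  split=> //; rewrite hU hG; split=> //; first by rewrite hP.
  + split=> //.
    * by move=> y hy; have -> : y = 1 by [lia]; rewrite big_geq.
    * by rewrite hP big_geq.
    * by move=> y j; lia.
  + by rewrite subn1 subn0.
  + by move=> y hy; exfalso; lia.
- move=> m k [f [hB [hN hL hG] [hU hg hUg] [hP hacq hf] [hS hb]]].
  rewrite /= hN addn1; case: ltnP => // h _.
  have e : m aU 0 = n.+1 by lia.
  move: hacq hP hb; rewrite (hUg e) e => hacq hP hb; split=> //; first by rewrite addn0 in hP.
  by move=> y hy; apply: hb; rewrite hy.
- by move=> f m k [].
- exact: pair_step.
Qed.

End PairLoop.

(** * Elimination order and greedy coloring *)

Definition vname (n x : nat) : bool := 0 < x <= n.

Definition cell (n h d : nat) : nat := h * n.+1 + d.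

Lemma cell_inj n h d h' d' : d <= n -> d' <= n ->
  (cell n h d == cell n h' d') = (h == h') && (d == d').
Proof.
move=> hd hd'; apply/eqP/andP => [e|[/eqP-> /eqP->]//].
have e1 := congr1 (fun x => x %/ n.+1) e; have e2 := congr1 (fun x => x %% n.+1) e.
move: e1 e2; rewrite /cell !divnMDl // !modnMDl !divn_small // !modn_small //.
by rewrite !addn0 => -> ->; rewrite !eqxx.
Qed.

Lemma sum_update n (h h' : nat -> nat) d v : d <= n ->
  (forall b, h' b = if b == d then v else h b) ->
  \sum_(b < n.+1) h' b + h d = \sum_(b < n.+1) h b + v.
Proof.
move=> hd e; rewrite (bigD1 (inord d)) //= [in RHS](bigD1 (inord d)) //= e inordK // eqxx.
rewrite (eq_bigr (fun b : 'I_n.+1 => h b)); first by lia.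
by move=> b /negbTE; rewrite -val_eqE /= inordK // e => ->.
Qed.

Lemma leq_sum_ord n (h : nat -> nat) d : d <= n -> h d <= \sum_(b < n.+1) h b.
Proof. by move=> hd; rewrite (bigD1 (inord d)) //= inordK // leq_addr. Qed.

Lemma leq_in_count (T : eqType) (a b : pred T) s :
  {in s, forall x, a x -> b x} -> count a s <= count b s.
Proof.
move=> h; rewrite (@eq_in_count _ a (predI a b) s); last first.
  by move=> x /h /=; case: (a x) => // ->.
by apply: sub_count => x /andP[].
Qed.

Section ColoringLoops.
Variables (pq nq : nat -> nat -> nat) (w : nat -> bool) (B F n l : nat).
Variable N : nat -> seq nat.
Hypotheses (F0 : 0 < F) (pqB : forall u v, pq u v <= B) (nqB : forall u v, nq u v <= B).
Hypotheses (FB : F <= B) (nB : n.+2 <= B) (lB : n.+1 * l <= B).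
Hypothesis N_range : forall v x, vname n v -> x \in N v -> vname n x.
Hypothesis N_sym : forall v x, vname n v -> vname n x ->
  count_mem x (N v) = count_mem v (N x).
Hypothesis N_irr : forall v, v \notin N v.
Hypothesis N_size : forall v, vname n v -> size (N v) <= n.
Let total := \sum_(1 <= z < n.+1) size (N z).
Hypothesis totalF : 2 * total + 2 * n <= F.

Definition stored (m : memory) : Prop :=
  forall v, vname n v -> m aStart v.+1 = m aStart v + size (N v) /\
    forall j, j < size (N v) -> m aTo (m aStart v + j) = nth 0 (N v) j.

Lemma acquired_stored m : acquired N n.+1 [::] m -> stored m.
Proof.
move=> [_ hS _ hT _] v /andP[v0 vn]; split; last by move=> j; apply: hT; rewrite v0.
by rewrite !hS ?v0 //= ?(leqW vn) // sum_size_rcons.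
Qed.

(** Only an inequality, since degrees fall while old entries stay in place. It suffices: a vertex
    popped from bucket [aK] needs degree at most [aK]. *)
Definition entries_ok (m : memory) : Prop :=
  forall b j, b <= n -> j < m aHt b ->
    vname n (m aBkt (cell n j b)) /\ m aDeg (m aBkt (cell n j b)) <= b.

Definition in_bucket (m : memory) (x b : nat) : Prop :=
  exists2 j, j < m aHt b & m aBkt (cell n j b) = x.

Definition fill_inv (f : nat) (m : memory) (k : nat) : Prop :=
  [/\ bounded B m, m aN 0 = n, stored m,
    [/\ 0 < m aV 0, m aV 0 <= n.+1, f = n.+1 - m aV 0 &
      \sum_(b < n.+1) m aHt b = (m aV 0).-1] &
    [/\ forall y, 0 < y < m aV 0 -> m aDeg y = size (N y) /\ in_bucket m y (m aDeg y),
      forall y, m aDeg y <= n &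
      forall b j, b <= n -> j < m aHt b -> 0 < m aBkt (cell n j b) < m aV 0 /\
         m aDeg (m aBkt (cell n j b)) <= b]].

Lemma fill_step f m k : fill_inv f m k -> eval m fill_guard != 0 ->
  exists2 f', f' < f & fill_inv f' (step pq nq w fill_body (m, k)).1
                                   (step pq nq w fill_body (m, k)).2.
Proof.
move=> [hB hN hst [v0 hV hf hsum] [hd hdn he]].
rewrite /= hN addn1 => h; have {h} hVn : m aV 0 <= n by move: h; case: ltnP.
have hv : vname n (m aV 0) by rewrite /vname v0.
have [hS hT] := hst _ hv; have hz := N_size hv.
rewrite /update /= !addn1 !hS addKn !hN.
exists (n.+1 - (m aV 0).+1); first by lia.
have hHt d : d <= n -> m aHt d <= n.
  by move=> /(leq_sum_ord (m aHt)); rewrite hsum; lia.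
have hH := hHt _ hz.
have ineq (y : nat) : 0 < y < m aV 0 -> (y == m aV 0) = false by lia.
rewrite -/(cell n (m aHt (size (N (m aV 0)))) (size (N (m aV 0)))).
split=> //=.
- by move=> a x /=; do !case: ifP => _ //; lia.
- split=> //; apply: (@addIn (m aHt (size (N (m aV 0))))).
  by rewrite (sum_update hz (fun b => erefl)) hsum; lia.
- split=> //; first 1 last.
  + by move=> y; case: ifP.
  + move=> b j hb hj; rewrite cell_inj //.
    move: hj; case: (eqVneq b (size (N (m aV 0)))) => [->|neb].
      rewrite andbT => hj; case: (eqVneq j (m aHt (size (N (m aV 0))))) => [_|nej].
        by rewrite eqxx v0 ltnS leqnn leqnn.
      have hj' : j < m aHt (size (N (m aV 0))) by lia.
      have [/[dup] /ineq -> h1 h2] := he _ _ hz hj'.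
      by split=> //; lia.
    rewrite andbF => hj; have [/[dup] /ineq -> h1 h2] := he _ _ hb hj.
    by split=> //; lia.
  + move=> y hy; case: (eqVneq y (m aV 0)) => [->|ney].
      by split=> //; exists (m aHt (size (N (m aV 0)))); rewrite /= ?eqxx.
    have hy' : 0 < y < m aV 0 by lia.
    have [h1 [j hj hx]] := hd _ hy'; split=> //.
    exists j => /=; rewrite h1 in hj hx *.
      by case: eqP => [e|//]; rewrite -e; lia.
    rewrite cell_inj //; last by apply: N_size; rewrite /vname; lia.
    by case: andP => // -[/eqP e1 /eqP e2]; move: hj; rewrite e1 -e2 ltnn.
Qed.

Lemma fill_loop :
  triple pq nq w B F
    (fun m k => [/\ bounded B m, m aN 0 = n, stored m & [/\ m aV 0 = 1,
        forall b, m aHt b = 0 & forall b, m aDeg b = 0]])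
    (While fill_guard fill_body)
    (fun m k => [/\ bounded B m, stored m, entries_ok m,
       \sum_(b < n.+1) m aHt b = n &
       forall y, vname n y -> m aDeg y = size (N y) /\ in_bucket m y (m aDeg y)]).
Proof.
apply: triple_conseq (triple_while F0 pqB nqB (I := fill_inv) _ _ _) => //.
- move=> m k [hB hN hst [hV hH hD]]; exists n; first by lia.
  split=> //; rewrite hV; split=> //; first by lia.
  + by rewrite big1.
  + by move=> y; lia.
  + by move=> y; rewrite hD.
  + by move=> b j _; rewrite hH.
- move=> m k [f [hB hN hst [v0 hV hf hsum] [hd hdn he]]].
  rewrite /= hN addn1; case: ltnP => // h _.
  have e : m aV 0 = n.+1 by lia.
  rewrite e in hsum hd he; split=> //.
- by move=> f m k [].
- exact: fill_step.
Qed.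

(** * Peeling by minimum degree *)

Definition degN (d : nat) : Prop :=
  forall S : pred nat, (exists2 v, vname n v & S v) ->
    exists v, [/\ vname n v, S v & count S (N v) <= d].

Definition alive (m : memory) : pred nat := fun x => m aRem x == 0.

Definition unscanned (m : memory) : seq nat :=
  [seq m aTo p | p <- iota (m aP 0) (m aEnd 0 - m aP 0)].

(** A removed vertex is dead at once, but its neighbors are decremented one by one; the term in
    [unscanned] counts the decrements still due. As [aK] never falls, a vertex whose degree drops
    below it waits in bucket [aK]. *)
Definition peel_deg (m : memory) : Prop :=
  forall x, vname n x -> alive m x ->
    [/\ m aDeg x = count (alive m) (N x) + count_mem x (unscanned m),
        m aDeg x <= n & in_bucket m x (maxn (m aDeg x) (m aK 0))].

Definition peel_order (m : memory) : Prop :=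
  [/\ forall x, vname n x -> ~~ alive m x ->
        [/\ m aRem x <= m aCnt 0, m aOrd (m aRem x).-1 = x &
            count (fun y => alive m y || (m aRem x < m aRem y)) (N x) <= m aK 0],
      forall i, i < m aCnt 0 -> vname n (m aOrd i) /\ m aRem (m aOrd i) = i.+1 &
      count (alive m) (iota 1 n) + m aCnt 0 = n].

(* The factor 2 pays for the bucket entry that the scan of an arc may create. *)
Definition peel_potential (m : memory) : nat :=
  2 * (\sum_(x <- iota 1 n | alive m x) size (N x) + size (unscanned m))
    + \sum_(b < n.+1) m aHt b + (n - m aK 0).

(** The clause on [degN] makes the order found optimal. The bound [f <= F] limits the bucket
    heights, hence the values in memory. *)
Definition peel_inv (f : nat) (m : memory) (k : nat) : Prop :=
  [/\ bounded B m, m aN 0 = n /\ stored m,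
    [/\ entries_ok m, peel_deg m & peel_order m],
    [/\ m aK 0 <= n, forall d, degN d -> m aK 0 <= d &
        forall x, x \in unscanned m -> vname n x]
    & f = peel_potential m /\ f <= F].

Lemma stored_eq m m' : m' aStart = m aStart -> m' aTo = m aTo -> stored m -> stored m'.
Proof. by move=> eS eT hst v /hst; rewrite eS eT. Qed.

Lemma count_alive_remove (a a' : pred nat) v s : a v ->
  (forall y, a' y = a y && (y != v)) -> count a s = count a' s + count_mem v s.
Proof.
move=> av ea; elim: s => //= y s ->; rewrite ea.
by case: (eqVneq y v) => [->|]; rewrite ?av ?andbT ?andbF; lia.
Qed.

Lemma peel_step_skip f m m' k : peel_inv f m k -> m aP 0 < m aEnd 0 ->
  ~~ alive m (m aTo (m aP 0)) -> bounded B m' ->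
  m' aP 0 = (m aP 0).+1 ->
  (forall a, a \notin [:: aP; aX] -> m' a = m a) ->
  exists2 f', f' < f & peel_inv f' m' k.
Proof.
move=> [hB [hN hst] [he hd ho] [hK hKd hun] [hf hfF]] hPE hx hB' eP fr.
have eA : alive m' = alive m by rewrite /alive fr.
have uE : unscanned m = m aTo (m aP 0) :: unscanned m'.
  by rewrite /unscanned eP !fr // -subnSK.
have pE : peel_potential m = peel_potential m' + 2.
  by rewrite /peel_potential uE eA !fr //= ; lia.
exists (peel_potential m'); first by lia.
split=> //; last by split=> //; lia.
- by split; [rewrite fr | apply: stored_eq hst; rewrite fr].
- split; first by move=> b j; rewrite !fr //; apply: he.
    move=> y vy; rewrite eA /in_bucket !fr // => ay; have [h1 h2 h3] := hd y vy ay.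
    split=> //; rewrite h1 uE /=; case: (eqVneq _ y) => // e.
    by rewrite e ay in hx.
  by case: ho => h1 h2 h3; rewrite /peel_order eA !fr.
- rewrite !fr //; split=> // y hy; apply: hun; by rewrite uE inE hy orbT.
Qed.

Lemma peel_step_push f m m' k : let x := m aTo (m aP 0) in
  let d := maxn (m aDeg x).-1 (m aK 0) in
  peel_inv f m k -> m aP 0 < m aEnd 0 -> alive m x -> bounded B m' ->
  m' aP 0 = (m aP 0).+1 ->
  (forall y, m' aDeg y = if y == x then (m aDeg x).-1 else m aDeg y) ->
  (forall b, m' aHt b = if b == d then (m aHt d).+1 else m aHt b) ->
  (forall i, m' aBkt i = if i == cell n (m aHt d) d then x else m aBkt i) ->
  (forall a, a \notin [:: aP; aX; aD; aDeg; aHt; aBkt] -> m' a = m a) ->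
  exists2 f', f' < f & peel_inv f' m' k.
Proof.
move=> x d [hB [hN hst] [he hd ho] [hK hKd hun] [hf hfF]] hPE hx hB' eP eD eH eBk fr.
have eA : alive m' = alive m by rewrite /alive fr.
have uE : unscanned m = x :: unscanned m'.
  by rewrite /unscanned eP !fr // -subnSK.
have vx : vname n x by apply: hun; rewrite uE mem_head.
have [dx1 dx2 _] := hd x vx hx.
have dn : d <= n by rewrite geq_max hK andbT; lia.
have hsum : \sum_(b < n.+1) m' aHt b = (\sum_(b < n.+1) m aHt b).+1.
  by have := sum_update dn eH; lia.
have pE : peel_potential m = (peel_potential m').+1.
  by rewrite /peel_potential hsum uE eA !fr //= ; lia.
exists (peel_potential m'); first by lia.
split=> //; last by split=> //; lia.
- by split; [rewrite fr | apply: stored_eq hst; rewrite fr].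
- split; last by case: ho => h1 h2 h3; rewrite /peel_order eA !fr.
    move=> b j hb; rewrite eH eBk cell_inj //.
    case: (eqVneq b d) => [->|nb].
      rewrite andbT => hj; case: (eqVneq j (m aHt d)) => [_|nj].
        by rewrite eD eqxx vx leq_maxl.
      have {}hj : j < m aHt d by lia.
      have [h1 h2] := he _ _ dn hj; split=> //; rewrite eD; case: eqP => // e.
      by rewrite -e; lia.
    rewrite andbF => hj; have [h1 h2] := he _ _ hb hj; split=> //.
    by rewrite eD; case: eqP => // e; rewrite -e; lia.
  move=> y vy; rewrite eA (fr aK) // => ay; have [h1 h2 [j hj hy]] := hd y vy ay.
  rewrite eD; case: (eqVneq y x) => [->|nyx].
    split=> //; [by rewrite dx1 uE /= eqxx; lia | by lia |].
    by exists (m aHt d); rewrite -/d ?eH ?eBk eqxx.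
  split=> //; first by rewrite h1 uE /= eq_sym (negbTE nyx).
  exists j; first by rewrite eH; case: eqP => // e; rewrite -e; lia.
  rewrite eBk cell_inj //; last by rewrite geq_max h2 hK.
  by case: andP => // -[/eqP e1 /eqP e2]; move: hj; rewrite e2 e1 ltnn.
- by rewrite fr //; split=> // y hy; apply: hun; rewrite uE inE hy orbT.
Qed.

(** With no arc pending and bucket [aK] empty, every living vertex has more than [aK] living
    neighbors. The living vertices then refute [degN d] for [d <= aK], which permits raising
    [aK]. *)
Lemma peel_step_next f m m' k : peel_inv f m k -> m aEnd 0 <= m aP 0 ->
  m aCnt 0 < n -> m aHt (m aK 0) = 0 -> bounded B m' ->
  m' aK 0 = (m aK 0).+1 -> (forall a, a \notin [:: aK] -> m' a = m a) ->
  exists2 f', f' < f & peel_inv f' m' k.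
Proof.
move=> [hB [hN hst] [he hd ho] [hK hKd hun] [hf hfF]] hPE hC hH hB' eK fr.
have eA : alive m' = alive m by rewrite /alive fr.
have uE : unscanned m = [::].
  by rewrite /unscanned; have -> : m aEnd 0 - m aP 0 = 0 by lia.
have uE' : unscanned m' = [::] by rewrite -uE /unscanned !fr.
have gtK y : vname n y -> alive m y -> m aK 0 < m aDeg y.
  move=> vy ay; have [_ _ [j hj _]] := hd y vy ay; rewrite ltnNge; apply/negP => h.
  by move: hj; rewrite (maxn_idPr h) hH.
have [v vv av] : exists2 v, vname n v & alive m v.
  have /hasP[v] : has (alive m) (iota 1 n) by case: ho => _ _ ?; rewrite has_count; lia.
  by rewrite mem_iota => hv av; exists v => //; rewrite /vname; lia.
have Kn : m aK 0 < n by have [_ h _] := hd v vv av; apply: leq_trans (gtK v vv av) h.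
have pE : peel_potential m = (peel_potential m').+1.
  by rewrite /peel_potential uE uE' eA eK !fr //; lia.
exists (peel_potential m'); first by lia.
split=> //; last by split=> //; lia.
- by split; [rewrite fr | apply: stored_eq hst; rewrite fr].
- split; first by move=> b j; rewrite !fr //; apply: he.
    move=> y vy; rewrite eA /in_bucket eK !fr // => ay; have [h1 h2 h3] := hd y vy ay.
    have h4 := gtK y vy ay; split=> //; first by rewrite uE' h1 uE.
    by move: h3; rewrite /in_bucket (maxn_idPl h4) (maxn_idPl (ltnW h4)).
  case: ho => h1 h2 h3; rewrite /peel_order eA eK !fr //; split=> // y vy ay.
  by have [? ? ?] := h1 y vy ay; split=> //; lia.
- rewrite eK; split=> //; last by rewrite uE'.
  move=> d hdd; have [|u [vu au]] := hdd (alive m); first by exists v.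
  apply: leq_trans; apply: leq_trans (gtK u vu au) _.
  by have [-> _ _] := hd u vu au; rewrite uE addn0.
Qed.

Lemma entries_pop m m' : entries_ok m ->
  (forall b, m' aHt b <= m aHt b) -> m' aBkt = m aBkt -> m' aDeg = m aDeg ->
  entries_ok m'.
Proof. by move=> he h eB eD b j hb hj; rewrite eB eD; apply: he => //; apply: leq_trans hj _. Qed.

Lemma in_bucket_pop m m' y b : in_bucket m y b -> b <= n -> m aK 0 <= n ->
  (forall b, m' aHt b = if b == m aK 0 then (m aHt (m aK 0)).-1 else m aHt b) ->
  m' aBkt = m aBkt ->
  y != m aBkt (cell n (m aHt (m aK 0)).-1 (m aK 0)) -> in_bucket m' y b.
Proof.
move=> [j hj hy] hb hK eH eB ny; exists j; last by rewrite eB.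
rewrite eH; case: eqP => // e; move: hj hy; rewrite e => hj hy.
case: (eqVneq j (m aHt (m aK 0)).-1) => ej; last by lia.
by move: ny; rewrite -hy ej eqxx.
Qed.

Lemma peel_step_stale f m m' k :
  let v := m aBkt (cell n (m aHt (m aK 0)).-1 (m aK 0)) in
  peel_inv f m k -> m aHt (m aK 0) != 0 -> ~~ alive m v -> bounded B m' ->
  (forall b, m' aHt b = if b == m aK 0 then (m aHt (m aK 0)).-1 else m aHt b) ->
  (forall a, a \notin [:: aHt; aV] -> m' a = m a) ->
  exists2 f', f' < f & peel_inv f' m' k.
Proof.
move=> v [hB [hN hst] [he hd ho] [hK hKd hun] [hf hfF]] hH hv hB' eH fr.
have eA : alive m' = alive m by rewrite /alive fr.
have uE : unscanned m' = unscanned m by rewrite /unscanned !fr.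
have hsum : \sum_(b < n.+1) m aHt b = (\sum_(b < n.+1) m' aHt b).+1.
  by have := sum_update hK eH; lia.
have pE : peel_potential m = (peel_potential m').+1.
  by rewrite /peel_potential hsum uE eA (fr aK) //; lia.
exists (peel_potential m'); first by lia.
split=> //; last by split=> //; lia.
- by split; [rewrite fr | apply: stored_eq hst; rewrite fr].
- split; last by case: ho => h1 h2 h3; rewrite /peel_order eA !fr.
    apply: entries_pop he _ (fr aBkt isT) (fr aDeg isT) => b; rewrite eH.
    by case: eqP => // ->; rewrite leq_pred.
  move=> y vy; rewrite eA uE (fr aK) // (fr aDeg) // => ay; have [h1 h2 h3] := hd y vy ay.
  split=> //; apply: (in_bucket_pop h3 _ hK eH (fr aBkt isT)).
    by rewrite geq_max h2 hK.
  by apply: contraNneq hv => e; rewrite /v -e.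
- by rewrite uE !(fr aK).
Qed.

(** No arc is pending, so [aDeg v] is the exact number of living neighbors of [v]. These are the
    neighbors removed later, and there are at most [aK] of them. *)
Lemma peel_step_remove f m m' k :
  let v := m aBkt (cell n (m aHt (m aK 0)).-1 (m aK 0)) in
  peel_inv f m k -> m aEnd 0 <= m aP 0 -> m aHt (m aK 0) != 0 ->
  alive m v -> bounded B m' ->
  (forall b, m' aHt b = if b == m aK 0 then (m aHt (m aK 0)).-1 else m aHt b) ->
  m' aP 0 = m aStart v -> m' aEnd 0 = m aStart v.+1 ->
  (forall i, m' aOrd i = if i == m aCnt 0 then v else m aOrd i) ->
  m' aCnt 0 = (m aCnt 0).+1 ->
  (forall y, m' aRem y = if y == v then (m aCnt 0).+1 else m aRem y) ->
  (forall a, a \notin [:: aHt; aV; aP; aEnd; aOrd; aCnt; aRem] -> m' a = m a) ->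
  exists2 f', f' < f & peel_inv f' m' k.
Proof.
move=> v [hB [hN hst] [he hd ho] [hK hKd hun] [hf hfF]] hPE hH av hB' eH eP eE eO eC eR fr.
have eA y : alive m' y = alive m y && (y != v).
  by rewrite /alive eR; case: (eqVneq y v) => [->|]; rewrite ?andbT ?andbF.
have uE : unscanned m = [::].
  by rewrite /unscanned; have -> : m aEnd 0 - m aP 0 = 0 by lia.
have [vv dv] : vname n v /\ m aDeg v <= m aK 0 by apply: he => //; lia.
have [hS hT] := hst v vv.
have uE' : unscanned m' = N v.
  rewrite /unscanned eP eE hS addKn fr // -[m aStart v]addn0 iotaDl -map_comp.
  apply: (@eq_from_nth _ 0); rewrite !size_map size_iota // => i hi.
  by rewrite (nth_map 0) ?size_iota //= nth_iota // add0n hT.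
have cA := count_alive_remove _ av eA.
have hsum : \sum_(b < n.+1) m aHt b = (\sum_(b < n.+1) m' aHt b).+1.
  by have := sum_update hK eH; lia.
have viota : v \in iota 1 n by rewrite mem_iota; move: vv; rewrite /vname; lia.
have sA : \sum_(x <- iota 1 n | alive m x) size (N x) =
    \sum_(x <- iota 1 n | alive m' x) size (N x) + size (N v).
  rewrite (big_rem v viota) /= av addnC; congr (_ + _).
  rewrite rem_filter ?iota_uniq // big_filter_cond; apply: eq_bigl => y.
  by rewrite eA /= andbC.
have pE : peel_potential m = (peel_potential m').+1.
  by rewrite /peel_potential hsum uE uE' sA (fr aK) //=; lia.
case: ho => h1 h2 h3.
have [dv1 _ _] := hd v vv av.
exists (peel_potential m'); first by lia.
split=> //; last by split=> //; lia.
- by split; [rewrite fr | apply: stored_eq hst; rewrite fr].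
- split.
  + apply: entries_pop he _ (fr aBkt isT) (fr aDeg isT) => b; rewrite eH.
    by case: eqP => // ->; rewrite leq_pred.
  + move=> y vy; rewrite eA uE' (fr aK) // (fr aDeg) // => /andP[ay nyv].
    have [d1 d2 d3] := hd y vy ay; split=> //.
      by rewrite d1 uE addn0 cA N_sym.
    apply: (in_bucket_pop d3 _ hK eH (fr aBkt isT) nyv).
    by rewrite geq_max d2 hK.
  + split.
    * move=> x vx; rewrite eA negb_and negbK eR eC (fr aK) // => hx.
      case: (eqVneq x v) => [->|nxv].
        split=> //; first by rewrite eO /= eqxx.
        apply: leq_trans dv; rewrite dv1 uE addn0.
        apply: leq_in_count => y yN.
        rewrite eA eR; case: (eqVneq y v) => [e|nyv].
          by move: (N_irr v); rewrite -{1}e yN.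
        rewrite andbT => /orP[//|hy]; apply: contraLR hy => hy.
        by have [] := h1 y (N_range vv yN) hy; lia.
      rewrite (negbTE nxv) orbF in hx; have [x1 x2 x3] := h1 x vx hx.
      have x0 : 0 < m aRem x by move: hx; rewrite /alive lt0n.
      split; [by lia | by rewrite eO; case: eqP => // e; lia |].
      (* For a vertex [x] removed earlier the count does not change: [v] passes from alive to
         removed after [x]. *)
      rewrite (eq_count (a2 := fun y => alive m y || (m aRem x < m aRem y))) // => y /=.
      rewrite eA eR; case: (eqVneq y v) => [->|]; last by rewrite andbT.
      by rewrite av /= ltnS x1.
    * move=> i; rewrite eC ltnS eO => hi; case: eqP => [->|ni].
        by rewrite eR eqxx.
      have [|i1 i2] := h2 i; first by lia.
      split=> //; rewrite eR; case: eqP => // e.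
      by move: av; rewrite -e /alive i2.
    * by rewrite eC; move: h3; rewrite cA count_uniq_mem ?iota_uniq // viota; lia.
- by rewrite uE' fr //; split=> // y; apply: N_range.
Qed.

Lemma peel_step f m k : peel_inv f m k -> eval m peel_guard != 0 ->
  exists2 f', f' < f & peel_inv f' (step pq nq w peel_body (m, k)).1
                                   (step pq nq w peel_body (m, k)).2.
Proof.
move=> hI; have [hB [hN hst] [he hd ho] [hK hKd hun] [hf hfF]] := hI.
rewrite /= hN => h; have {h} hC : m aCnt 0 < n by move: h; case: ltnP.
have -> : ((m aP 0 < m aEnd 0) : nat) != 0 = (m aP 0 < m aEnd 0) by case: ltnP.
case: ltnP => hPE.
- set x := m aTo (m aP 0).
  have PB : (m aP 0).+1 <= B by apply: leq_trans (hB aEnd 0).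
  rewrite /update /= -/x !hN !addn1 ?eqxx.
  case: ifPn => hx /=.
    apply: (peel_step_skip hI) => //; first by move=> a i; do !case: ifP => _ //; apply: hB.
    by move=> a; rewrite !inE !negb_or => /andP[/negbTE -> /negbTE ->].
  have ax : alive m x by move: hx; rewrite negbK.
  (* [a + (b - a)] with truncated subtraction is the maximum of [a] and [b]. *)
  have -> : m aDeg x - 1 + (m aK 0 - (m aDeg x - 1)) = maxn (m aDeg x).-1 (m aK 0).
    by rewrite maxnE subn1.
  set d := maxn _ _.
  have uE : unscanned m = x :: [seq m aTo p | p <- iota (m aP 0).+1 (m aEnd 0 - (m aP 0).+1)].
    by rewrite /unscanned -subnSK.
  have vx : vname n x by apply: hun; rewrite uE mem_head.
  have [dx1 dx2 _] := hd x vx ax.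
  have dn : d <= n by rewrite geq_max hK andbT; lia.
  (* The pending arc weighs 2 in the potential, which leaves room for one more entry below [F]. *)
  have hHd : (m aHt d).+1 <= B.
    have := leq_sum_ord (m aHt) dn; move: hfF; rewrite hf /peel_potential uE /=; lia.
  apply: (peel_step_push hI) => //.
  + move=> a i /=; do !case: ifP => _ //; try exact: hB; first by lia.
    by apply: leq_trans (hB aDeg x); rewrite leq_subr.
  + by move=> y /=; rewrite subn1.
  + move=> a; rewrite !inE !negb_or => /andP[/negbTE -> /andP[/negbTE ->]].
    by case/andP=> /negbTE -> /andP[/negbTE ->] /andP[/negbTE -> /negbTE ->].
- case: ifPn => hH /=; last first.
    apply: (peel_step_next hI) => //=; rewrite /update /=.
    + by move: hH; rewrite negbK => /eqP.
    + by move=> a i /=; case: ifP => _ //; lia.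
    + by rewrite addn1.
    + by move=> a; rewrite !inE => /negbTE ->.
  rewrite /update /= !hN !addn1 !eqxx !subn1.
  set v := m aBkt _.
  case: ifPn => hv /=.
    apply: (peel_step_stale hI) => //.
    + move=> a i /=; do !case: ifP => _ //; try exact: hB.
      exact: leq_trans (leq_pred _) (hB _ _).
    + by move=> a; rewrite !inE !negb_or => /andP[/negbTE -> /negbTE ->].
  apply: (peel_step_remove hI) => //=.
  + by move: hv; rewrite negbK.
  + move=> a i /=; do !case: ifP => _ //; try exact: hB; try lia.
    exact: leq_trans (leq_pred _) (hB _ _).
  + move=> a; rewrite !inE !negb_or => /andP[/negbTE -> /andP[/negbTE ->]].
    by case/andP=> /negbTE -> /andP[/negbTE ->] /andP[/negbTE -> /andP[/negbTE -> /negbTE ->]].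
Qed.

Definition elimination_order (m : memory) (kk : nat) : Prop :=
  [/\ forall x, vname n x -> [/\ 0 < m aRem x <= n, m aOrd (m aRem x).-1 = x &
        count (fun y => m aRem x < m aRem y) (N x) <= kk] &
      forall i, i < n -> vname n (m aOrd i) /\ m aRem (m aOrd i) = i.+1].

Lemma sum_iota (f : nat -> nat) : \sum_(x <- iota 1 n) f x = \sum_(1 <= x < n.+1) f x.
Proof. by rewrite /index_iota subn1. Qed.

Lemma peel_loop :
  triple pq nq w B F
    (fun m k => [/\ bounded B m, m aN 0 = n /\ stored m, entries_ok m /\
       \sum_(b < n.+1) m aHt b = n,
       forall y, vname n y -> m aDeg y = size (N y) /\ in_bucket m y (m aDeg y) &
       [/\ forall x, m aRem x = 0, m aCnt 0 = 0, m aK 0 = 0 & m aEnd 0 = 0]])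
    (While peel_guard peel_body)
    (fun m k => [/\ bounded B m, stored m &
       exists2 kk, forall d, degN d -> kk <= d & elimination_order m kk]).
Proof.
apply: triple_conseq (triple_while F0 pqB nqB (I := peel_inv) _ _ _) => //.
- move=> m k [hB [hN hst] [he hs] hd [hR hC hK hE]].
  have aE : alive m =1 xpredT by move=> x; rewrite /alive hR.
  have uE : unscanned m = [::] by rewrite /unscanned hE.
  have pE : peel_potential m = 2 * total + n + n.
    by rewrite /peel_potential uE hs hK addn0 subn0 (eq_bigl _ _ aE) sum_iota.
  exists (peel_potential m); first by lia.
  split=> //; last by split=> //; lia.
  + split=> //.
      move=> x vx _; have [h1 h2] := hd x vx; rewrite uE hK maxn0 addn0 (eq_count aE).
      by rewrite count_predT h1; split=> //; [exact: N_size | rewrite h1 in h2].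
    split=> [x _||]; rewrite ?aE // ?hC //.
    by rewrite (eq_count aE) count_predT size_iota addn0.
  + by rewrite hK uE.
- move=> m k [f [hB [hN hst] [he hd [h1 h2 h3]] [hK hKd hun] [hf hfF]]].
  rewrite /= hN; case: ltnP => // hC _.
  have eC : m aCnt 0 = n by lia.
  have dead x : vname n x -> ~~ alive m x.
    move=> vx; have : ~~ has (alive m) (iota 1 n) by rewrite has_count; lia.
    by move/hasPn; apply; rewrite mem_iota; move: vx; rewrite /vname; lia.
  split=> //; exists (m aK 0) => //; split; last by move=> i hi; apply: h2; rewrite eC.
  move=> x vx; have [x1 x2 x3] := h1 x vx (dead x vx); split=> //.
    by rewrite lt0n; apply/andP; split; [exact: (dead x vx) | rewrite -eC].
  apply: leq_trans x3; apply: sub_count => y hy; by rewrite hy orbT.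
- by move=> f m k [].
- exact: peel_step.
Qed.

(** * Greedy coloring in reverse elimination order *)

Section ColorLoop.
Variable kk : nat.

Definition colored (m : memory) : Prop :=
  let i := m aI 0 in
  [/\ forall x, vname n x -> i < m aRem x ->
        0 < m aCol x <= kk.+1 /\ m aOut x = (m aCol x).-1 * l + m aBlk x,
      forall x, vname n x -> m aRem x <= i -> m aCol x = 0 &
      forall x y, vname n x -> vname n y -> i < m aRem x -> i < m aRem y ->
        y \in N x -> m aCol x != m aCol y].

(** Marks are stamped with the vertex [v] being colored, so they are never cleared. Uncolored
    neighbors have color 0 and stamp only the color 0, while candidates start at 1. *)
Definition color_scan (m : memory) (j : nat) : Prop :=
  let v := m aV 0 in
  [/\ v = m aOrd (m aI 0).-1,
      m aP 0 = m aStart v + j /\ m aEnd 0 = m aStart v + size (N v),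
      [/\ j <= size (N v), 0 < m aC 0 & j < size (N v) -> m aC 0 = 1],
      forall c, (m aMark c == v) = (c \in [seq m aCol y | y <- take j (N v)]) &
      forall c, 0 < c < m aC 0 -> m aMark c = v].

(** Stamps come only from vertices treated up to now, so the next vertex starts without a mark of
    its own. *)
Definition marks_old (m : memory) : Prop :=
  forall c, m aMark c = 0 \/ vname n (m aMark c) /\ m aI 0 <= m aRem (m aMark c).

(** A vertex of degree [d] costs [d] arc scans, at most [d] rejected candidates and one
    assignment. *)
Definition color_work (m : memory) : nat :=
  \sum_(t < m aI 0) (2 * size (N (m aOrd t)) + 2).

Definition color_inv (f : nat) (m : memory) (k : nat) : Prop :=
  [/\ bounded B m, m aL 0 = l /\ (forall y, vname n y -> m aBlk y < l),
    stored m /\ elimination_order m kk,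
    [/\ m aI 0 <= n, colored m & marks_old m] &
    0 < m aI 0 -> exists2 j, color_scan m j & f = color_work m - (j + (m aC 0).-1)].

Lemma color_step f m k : color_inv f m k -> eval m (sc aI) != 0 ->
  exists2 f', f' < f & color_inv f' (step pq nq w color_body (m, k)).1
                                    (step pq nq w color_body (m, k)).2.
Proof.
move=> [hB [hL hb] [hst [hr hor]] [hi [hc hu hp] hmo] hsc] /=.
rewrite -lt0n => i0; have {hsc} [j [hv [hP hE] [hj hC hC1] hm hlt] hf] := hsc i0.
have i1 : (m aI 0).-1 < n by lia.
have [vv rv] := hor _ i1; rewrite -hv prednK // in vv rv.
set v := m aV 0 in hv hP hE hj hC1 hm hlt vv rv *.
have [hS hT] := hst v vv.
have hz := N_size vv.
(* Pigeonhole: [c.-1] distinct marked colors need as many scanned neighbors. *)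
have cE (c : nat) : (forall c', 0 < c' < c -> m aMark c' = v) -> c.-1 <= j.
  move=> h; rewrite -(size_iota 1 c.-1);
  apply: (leq_trans (n := size [seq m aCol y | y <- take j (N v)])).
    apply: uniq_leq_size (iota_uniq _ _) _ => c'; rewrite mem_iota -hm => hc'.
    by rewrite h //; lia.
  by rewrite size_map size_takel.
have fE : color_work m =
    \sum_(t < (m aI 0).-1) (2 * size (N (m aOrd t)) + 2) + (2 * size (N v) + 2).
  by rewrite /color_work hv; case: (m aI 0) i0 => // i _; rewrite big_ord_recr.
have -> : ((m aP 0 < m aEnd 0) : nat) != 0 = (j < size (N v)).
  by rewrite hP hE ltn_add2l; case: ltnP.
case: ltnP => hjs.
  have C1 := hC1 hjs.
  rewrite /update /= hP hT // addn1.
  exists (color_work m - (j.+1 + (m aC 0).-1)); first by rewrite hf fE C1; lia.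
  split=> //=.
  - move=> a x /=; do !case: ifP => _ //; last exact: hB.
    by apply: leq_trans (hB aEnd 0); rewrite hE; lia.
  - split; [by [] | by split | move=> c /=].
    case: eqP => [_|_]; last exact: hmo.
    by right; rewrite -/v rv.
  - move=> _; exists j.+1 => //; split=> //=.
    + by split=> //; rewrite addnS.
    + move=> c; rewrite -/v (take_nth 0) // map_rcons mem_rcons inE -hm.
      by case: (c == _) => //=; rewrite eqxx.
    + by move=> c; rewrite C1; lia.
have ej : j = size (N v) by lia.
have -> : ((m aMark (m aC 0) == v) : nat) != 0 = (m aMark (m aC 0) == v).
  by case: (_ == v).
case: ifPn => hMC.
  have cj : m aC 0 <= j.
    rewrite -[m aC 0]/((m aC 0).+1.-1); apply: cE => c hc'.
    by case: (eqVneq c (m aC 0)) => [->|nc]; [exact/eqP | apply: hlt; lia].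
  rewrite /= /update /= addn1.
  exists (color_work m - (j + (m aC 0).+1.-1)); first by rewrite hf fE /=; lia.
  split=> //=.
  - by move=> a x /=; do !case: ifP => _ //; lia.
  - move=> _; exists j => //; split=> //=; first by rewrite -/v; split=> //; lia.
    move=> c hc'; case: (eqVneq c (m aC 0)) => [->|nc]; [exact/eqP | apply: hlt; lia].
have cj := cE _ hlt.
rewrite /= /update /= !subn1 !addn1 hL -/v.
set i' := (m aI 0).-1.
have ltI y : (i' < m aRem y) = (m aI 0 <= m aRem y) by rewrite /i' -ltnS prednK.
have eqv y : vname n y -> m aRem y = m aI 0 -> y = v.
  by move=> vy ry; have [_ <- _] := hr y vy; rewrite ry -hv.
have nbr y : y \in N v -> m aMark (m aCol y) = v.
  by move=> yN; apply/eqP; rewrite hm ej take_size; apply: map_f.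
(* All smaller candidates are colors of neighbors of [v]. A positive color means a later place in
   the order, and at most [kk] neighbors are later. *)
have ck : m aC 0 <= kk.+1.
  have [_ _ ckk] := hr v vv; apply: leq_trans (_ : (m aC 0).-1.+1 <= _); first by lia.
  rewrite ltnS; apply: leq_trans ckk; rewrite -size_filter -(size_map (m aCol)).
  rewrite -{1}(size_iota 1 (m aC 0).-1).
  apply: uniq_leq_size (iota_uniq _ _) _ => c; rewrite mem_iota => hc'.
  have : m aMark c == v by rewrite hlt //; lia.
  rewrite hm ej take_size => /mapP[y yN ey]; apply/mapP; exists y => //.
  rewrite mem_filter yN andbT rv ltnNge; apply/negP => h.
  by have := hu y (N_range vv yN) h; lia.
exists (\sum_(t < i') (2 * size (N (m aOrd t)) + 2)).
  rewrite hf fE /i'; move: (\sum_(t < _) _) => z; rewrite ej; lia.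
have coE y : m aRem y <= i' -> y == v = false.
  by move=> hy; apply/eqP => e; move: hy; rewrite e rv /i'; lia.
split=> //=.
- move=> a x /=; do !case: ifP => _ //; try exact: hB; try by lia.
  by apply: leq_trans lB; rewrite mulSn; have := hb v vv; nia.
- split=> //; first by lia.
  + split=> //=.
    * move=> x vx; rewrite ltI; case: (eqVneq x v) => [-> _|nx hx].
        by rewrite hC.
      apply: hc => //; rewrite ltn_neqAle hx andbT; apply/eqP => e.
      by move: nx; rewrite (eqv x vx (esym e)) eqxx.
    * by move=> x vx hx; rewrite coE //; apply: hu => //; rewrite /i' in hx; lia.
    * have st x : vname n x -> x != v -> m aI 0 <= m aRem x -> m aI 0 < m aRem x.
        move=> vx nx hx; rewrite ltn_neqAle hx andbT; apply/eqP => e.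
        by move: nx; rewrite (eqv x vx (esym e)) eqxx.
      move=> x y vx vy; rewrite !ltI => hx hy yN.
      case: (eqVneq x v) yN => [->|nx] yN; case: (eqVneq y v) yN => [->|ny] yN.
      - by move: (N_irr v); rewrite yN.
      - by apply: contraNneq hMC => ->; rewrite nbr.
      - have xN : x \in N v by move: yN; rewrite -!has_pred1 !has_count N_sym.
        by apply: contraNneq hMC => <-; rewrite nbr.
      - by apply: hp => //; apply: st.
  + move=> c /=; case: (hmo c) => [->|[h1 h2]]; [by left | right; split=> //].
    by rewrite /i'; lia.
- move=> i'0; exists 0; last by rewrite /color_work /= subn0.
  have i'n : i'.-1 < n by rewrite /i'; lia.
  have [vv' rv'] := hor _ i'n; have [hS' hT'] := hst _ vv'.
  split=> //=.
  + by rewrite addn0.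
  + move=> c; rewrite take0 /=; apply/eqP => e.
    case: (hmo c) => [h0|[_]]; first by move: vv'; rewrite -e h0.
    by rewrite e rv' /i'; lia.
  + by move=> c; lia.
Qed.

Lemma color_loop :
  triple pq nq w B F
    (fun m k => [/\ bounded B m, m aL 0 = l /\ (forall y, vname n y -> m aBlk y < l),
       stored m /\ elimination_order m kk,
       [/\ m aI 0 = n, forall x, m aCol x = 0 & forall c, m aMark c = 0] &
       [/\ m aV 0 = m aOrd n.-1, m aP 0 = m aStart (m aV 0),
           m aEnd 0 = m aStart (m aV 0).+1 & m aC 0 = 1]])
    (While (sc aI) color_body)
    (fun m k => forall x, vname n x ->
       exists2 c, [/\ m aOut x = c * l + m aBlk x, c <= kk & m aBlk x < l] &
         forall y, y \in N x -> m aBlk y = m aBlk x -> m aOut y <> m aOut x).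
Proof.
apply: triple_conseq (triple_while F0 pqB nqB (I := color_inv) _ _ _) => //.
- move=> m k [hB [hL hb] [hst ho] [hI hCo hM] [hV hP hE hC]].
  have [hr hor] := ho.
  (* [aOrd] enumerates every name once, so the work is [2 * total + 2 * n]. *)
  have le : color_work m <= F.
    apply: leq_trans totalF; rewrite /color_work hI big_split /= sum_nat_const card_ord.
    rewrite (mulnC n) leq_add2r -big_distrr /= leq_mul2l /= /total -sum_iota.
    rewrite -(big_mkord xpredT (fun t => size (N (m aOrd t)))) /=.
    rewrite -(big_map (m aOrd) xpredT (fun x => size (N x))).
    apply/eq_leq/perm_big/uniq_perm; rewrite ?iota_uniq //.
      rewrite map_inj_in_uniq ?iota_uniq // => a b; rewrite !mem_index_iota /= => ha hb' e.
      by have [_ ra] := hor a ha; have [_ rb] := hor b hb'; move: ra; rewrite e rb => -[].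
    move=> x; rewrite mem_iota; apply/mapP/idP => [[a]|hx].
      by rewrite mem_index_iota /= => ha ->; have [] := hor a ha; rewrite /vname; lia.
    have vx : vname n x by rewrite /vname; lia.
    have [x1 x2 _] := hr x vx; exists (m aRem x).-1 => //; rewrite mem_index_iota; lia.
  exists (color_work m) => //; split=> //.
  + split=> //; first by rewrite hI.
      split=> //; rewrite hI.
      * by move=> x vx; have [? _ _] := hr x vx; lia.
      * by move=> x y vx vy; have [? _ _] := hr x vx; lia.
    by move=> c; left.
  + rewrite hI => n0; have n1 : n.-1 < n by lia.
    have [vv rv] := hor _ n1; have [hS _] := hst _ vv.
    exists 0; last by rewrite hC subn0.
    split=> //; rewrite ?hI //.
    * by rewrite addn0 hP hE hV hS.
    * by rewrite hC.
    * by move=> c; rewrite take0 hM hV; apply/eqP => e; move: vv; rewrite -e.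
    * by move=> c; rewrite hC; lia.
- move=> m k [f [hB [hL hb] [hst [hr hor]] [hi [hc hu hp] hmo] _]] /= hI x vx.
  have col y : vname n y -> m aI 0 < m aRem y by move=> vy; have [] := hr y vy; lia.
  have [c1 c2] := hc x vx (col x vx); exists (m aCol x).-1; first by split; [|lia|exact: hb].
  move=> y yN eb; have vy := N_range vx yN; have [d1 d2] := hc y vy (col y vy).
  have l0 : 0 < l by have := hb x vx; lia.
  have /eqP ne := hp x y vx vy (col x vx) (col y vy) yN.
  rewrite c2 d2 eb => /addIn /eqP; rewrite eqn_pmul2r // => /eqP e; apply: ne; lia.
- by move=> f m k [].
- exact: color_step.
Qed.

End ColorLoop.

End ColoringLoops.

Lemma triple_ex (T : Type) pq nq w B F (P : T -> memory -> nat -> Prop) c Q :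
  (forall t, triple pq nq w B F (P t) c Q) ->
  triple pq nq w B F (fun m k => exists t, P t m k) c Q.
Proof. by move=> h s [t ht]; apply: h ht. Qed.

Definition zero_on (Z : seq nat) (m : memory) : Prop :=
  forall a i, a \in Z -> m a i = 0.

(** With [bl x < l], the residue of a color mod [l] is the block, so blocks use disjoint palettes.
    The first clause makes [kk] as small as any degeneracy bound of the lists. *)
Definition coloring_of (n l : nat) (N : nat -> seq nat) (bl : nat -> nat)
    (kk : nat) (out : nat -> nat) : Prop :=
  [/\ forall d, degN n N d -> kk <= d,
      forall x, vname n x -> exists2 c, out x = c * l + bl x & c <= kk &
      forall x y, vname n x -> y \in N x -> bl y = bl x -> out y <> out x].

Section ColoringPart.
Variables (pq nq : nat -> nat -> nat) (w : nat -> bool) (B F n l : nat).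
Variables (N : nat -> seq nat) (bl : nat -> nat).
Hypotheses (F0 : 0 < F) (pqB : forall u v, pq u v <= B) (nqB : forall u v, nq u v <= B).
Hypotheses (FB : F <= B) (nB : n.+2 <= B) (lB : n.+1 * l <= B).
Hypothesis N_range : forall v x, vname n v -> x \in N v -> vname n x.
Hypothesis N_sym : forall v x, vname n v -> vname n x ->
  count_mem x (N v) = count_mem v (N x).
Hypothesis N_irr : forall v, v \notin N v.
Hypothesis N_size : forall v, vname n v -> size (N v) <= n.
Hypothesis totalF : 2 * (\sum_(1 <= z < n.+1) size (N z)) + 2 * n <= F.
Hypothesis bl_lt : forall y, vname n y -> bl y < l.

(** Serves both outcomes of the reading phase: the full lists with [l = 1] and a single block 0, and
    the lists [mates]. *)
Lemma coloring_part_spec :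
  triple pq nq w B F
    (fun m k => [/\ bounded B m, m aN 0 = n /\ m aL 0 = l, stored n N m,
       forall y, vname n y -> m aBlk y = bl y &
       zero_on [:: aHt; aDeg; aRem; aCnt; aK; aEnd; aCol; aMark] m])
    coloring_part
    (fun m k => exists kk, coloring_of n l N bl kk (m aOut)).
Proof.
pose Phi1 Z m := [/\ m aN 0 = n, m aL 0 = l,
  forall y, vname n y -> m aBlk y = bl y & zero_on Z m].
have fr1 Z c m m' : aN \notin writes c -> aL \notin writes c -> aBlk \notin writes c ->
    (forall a, a \in Z -> a \notin writes c) ->
    (forall a, a \notin writes c -> forall i, m' a i = m a i) -> Phi1 Z m -> Phi1 Z m'.
  move=> w1 w2 w3 wZ fr [h1 h2 h3 h4]; rewrite /Phi1 !fr //; split=> //.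
    by move=> y vy; rewrite fr // h3.
  by move=> a i aZ; rewrite fr ?h4 // wZ.
pose Z1 := [:: aRem; aCnt; aK; aEnd; aCol; aMark].
pose Z2 := [:: aCol; aMark].
have sub : {subset Z1 <= [:: aHt; aDeg; aRem; aCnt; aK; aEnd; aCol; aMark]} by exact/allP.
apply: (triple_seq F0 (Q := fun m k => [/\ bounded B m, m aN 0 = n, stored n N m &
    [/\ m aV 0 = 1, forall b, m aHt b = 0 & forall b, m aDeg b = 0]] /\ Phi1 Z1 m)).
  apply: (triple_flat F0 pqB nqB) => // m k [hB [hN hL] hst hb hz] //=; split; split=> //.
  - by apply: bounded_update => //; lia.
  - by split=> // b; rewrite /update /=; apply: hz.
  - move=> a i; rewrite /update; case: (eqVneq a aV) => [->//|_ hZ].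
    exact: hz (sub _ hZ).
have /(triple_frame (Phi := Phi1 Z1)) Hf := fill_loop w F0 pqB nqB FB nB lB N_size totalF.
apply: (triple_seq F0 (Hf _)).
  by move=> m m'; apply: fr1 => // a; rewrite !inE => /or4P[|||/or3P[]] /eqP ->.
apply: (triple_seq F0 (Q := fun m k => [/\ bounded B m, stored n N m &
       exists2 kk, forall d, degN n N d -> kk <= d & elimination_order n N m kk] /\ Phi1 Z2 m)).
  apply: triple_conseq (triple_frame (Phi := Phi1 Z2) _
    (peel_loop w F0 pqB nqB FB nB lB N_range N_sym N_irr N_size totalF)); last 2 first.
  - by [].
  - by move=> m m'; apply: fr1 => // a; rewrite !inE => /orP[] /eqP ->.
  move=> m k [[hB hst he hs hd] [hN hL hb hz]]; split; last first.
    by split=> // a i; rewrite !inE => /orP[] /eqP ->; apply: hz.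
  split=> //; split; move=> *; exact: hz.
apply: (triple_seq F0 (Q := fun m k => exists kk, ([/\ bounded B m,
       m aL 0 = l /\ (forall y, vname n y -> m aBlk y < l),
       stored n N m /\ elimination_order n N m kk,
       [/\ m aI 0 = n, forall x, m aCol x = 0 & forall c, m aMark c = 0] &
       [/\ m aV 0 = m aOrd n.-1, m aP 0 = m aStart (m aV 0),
           m aEnd 0 = m aStart (m aV 0).+1 & m aC 0 = 1]]) /\
       ((forall y, vname n y -> m aBlk y = bl y) /\ forall d, degN n N d -> kk <= d))).
  apply: (triple_flat F0 pqB nqB) => // [m k [[]]//|m k [[hB hst [kk hkk ho]] [hN hL hb hz]] /=].
  exists kk; rewrite /update /=; split=> //.
  split=> //=; rewrite ?hN ?addn1 ?subn1 //.
  - by move=> a x /=; do !case: ifP => _ //; lia.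
  - by split=> // y vy; rewrite hb // bl_lt.
  - by split=> // x; apply: hz.
apply: triple_ex => kk.
apply: triple_conseq (triple_frame (Phi := fun m => (forall y, vname n y -> m aBlk y = bl y)
    /\ forall d, degN n N d -> kk <= d) _
  (color_loop w F0 pqB nqB FB nB lB N_range N_sym N_irr N_size totalF (kk := kk))) => //.
  move=> m k [h [hb hkk]]; exists kk; split=> //.
    by move=> x vx; have [c [h1 h2 _] _] := h x vx; exists c => //; rewrite -hb.
  move=> x y vx yN e; have [c _ h2] := h x vx; apply: h2 => //.
  by rewrite !hb // (N_range vx).
by move=> m m' fr [hb hkk]; split=> // y vy; rewrite fr // hb.
Qed.

End ColoringPart.

(** * The whole program *)

Lemma triple_or pq nq w B F P1 P2 c Q :
  triple pq nq w B F P1 c Q -> triple pq nq w B F P2 c Q ->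
  triple pq nq w B F (fun m k => P1 m k \/ P2 m k) c Q.
Proof. by move=> h1 h2 s [/h1|/h2]. Qed.

(** * Machine names and the two graphs to be colored *)

Lemma vertexP n u : vname n u -> exists2 x : 'I_n, vertex n u = Some x & u = x.+1.
Proof.
case: u => // u /andP[_ hu]; exists (Ordinal hu) => //=.
by rewrite insubT.
Qed.

Lemma vertex_Some n u x : vertex n u = Some x -> vname n u /\ u = x.+1.
Proof.
case: u => //= u; case: insubP => // y hu yu [<-].
by rewrite /vname -yu ltn_ord.
Qed.

Lemma vertex_succ n (x : 'I_n) : vertex n x.+1 = Some x.
Proof. exact: valK. Qed.

Definition nbr_names n (adj : 'I_n -> seq 'I_n) (u : nat) : seq nat :=
  if vertex n u is Some x then [seq (nat_of_ord y).+1 | y <- adj x] else [::].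

Lemma count_mem_sym (T : eqType) (N : T -> seq T) (u v : T) :
  uniq (N u) -> uniq (N v) -> (v \in N u) = (u \in N v) ->
  count_mem v (N u) = count_mem u (N v).
Proof. by move=> h1 h2 e; rewrite !count_uniq_mem // e. Qed.

Lemma size_names n (s : seq nat) : uniq s -> {in s, forall x, vname n x} -> size s <= n.
Proof.
move=> us hs; rewrite -(size_iota 1 n); apply: uniq_leq_size us _ => x /hs.
by rewrite mem_iota /vname; lia.
Qed.

Section Names.
Variables (n : nat) (e : rel 'I_n) (adj : 'I_n -> seq 'I_n).
Hypotheses (ge : simple_graph e) (ha : adjacency_lists e adj).

Let N := nbr_names adj.

Lemma pair_query_sym u v : pair_query e u v = pair_query e v u.
Proof.
rewrite /pair_query; case: (vertex n u) => [x|]; case: (vertex n v) => [y|] //.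
by case: ge => ->.
Qed.

Lemma pair_query_neq0 u v : pair_query e u v != 0 -> vname n u /\ vname n v.
Proof.
rewrite /pair_query; case eu: (vertex n u) => [x|] //; case ev: (vertex n v) => [y|] // _.
by have [] := vertex_Some eu; have [] := vertex_Some ev.
Qed.

Lemma pair_query_irr u : pair_query e u u = 0.
Proof. by rewrite /pair_query; case: (vertex n u) => // x; case: ge => _ ->. Qed.

Lemma pair_query_le u v : pair_query e u v <= 1.
Proof.
by rewrite /pair_query; case: (vertex n u) => // x; case: (vertex n v) => // y; case: (e x y).
Qed.

Lemma nbr_query_le u j : nbr_query adj u j <= n.
Proof.
rewrite /nbr_query; case: (vertex n u) => // x.
have [hj|hj] := ltnP j (size (0 :: [seq (nat_of_ord y).+1 | y <- adj x])); last first.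
  by rewrite nth_default.
by have := mem_nth 0 hj; rewrite inE => /orP[/eqP ->//|/mapP[y _ ->]].
Qed.

Lemma nbr_names_uniq u : uniq (N u).
Proof.
rewrite /N /nbr_names; case: (vertex n u) => // x.
by rewrite map_inj_uniq; [have [] := ha x | move=> y z [] /val_inj].
Qed.

Lemma mem_nbr_names u v : (v \in N u) = (pair_query e u v != 0).
Proof.
rewrite /N /nbr_names /pair_query; case: (vertex n u) => [x|] //.
apply/mapP/idP => [[y yx ->]|].
  by rewrite vertex_succ; case: (ha x) => _ <-; rewrite yx.
case ev: (vertex n v) => [y|] //; have [_ ->] := vertex_Some ev.
by case exy: (e x y) => // _; exists y => //; case: (ha x) => _ ->.
Qed.

Lemma nbr_names_range v x : vname n v -> x \in N v -> vname n x.
Proof. by rewrite mem_nbr_names => _ /pair_query_neq0[]. Qed.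

Lemma nbr_names_sym v x : vname n v -> vname n x -> count_mem x (N v) = count_mem v (N x).
Proof.
by move=> _ _; apply: count_mem_sym (nbr_names_uniq _) (nbr_names_uniq _) _;
  rewrite !mem_nbr_names pair_query_sym.
Qed.

Lemma nbr_names_irr v : v \notin N v.
Proof. by rewrite mem_nbr_names pair_query_irr. Qed.

Lemma nbr_names_size v : vname n v -> size (N v) <= n.
Proof. by move=> vv; apply: size_names (nbr_names_uniq _) _ => x; apply: nbr_names_range. Qed.

Lemma nbr_names_query u j : 0 < u <= n -> nbr_query adj u j.+1 = nth 0 (N u) j.
Proof. by move=> /vertexP[x hx _]; rewrite /nbr_query /N /nbr_names hx. Qed.

Lemma nbr_names_pos u : 0 \notin N u.
Proof.
by rewrite mem_nbr_names; apply/negP => /pair_query_neq0[_].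
Qed.

Section Mates.
Variables (sh : nat -> nat) (l gam : nat).
Hypotheses (l0 : 0 < l) (sh_lt : forall g, sh g < l) (grp : n < gam * l).

Let N2 u := mates (pair_query e) sh l u gam.

Lemma blk_lt u : blk sh l u < l.
Proof. by rewrite ltn_mod. Qed.

Lemma mate_div u g : (mate sh l u g).-1 %/ l = g.
Proof. by rewrite /mate addn1 /= divnMDl // divn_small ?addn0 // ltn_mod. Qed.

Lemma mates_uniq u : uniq (N2 u).
Proof.
apply: filter_uniq; rewrite map_inj_uniq ?iota_uniq // => g g' eg.
by rewrite -(mate_div u g) eg mate_div.
Qed.

Lemma mod_shift a b r : a < l -> b < l -> r < l ->
  (a == (b + r) %% l) = ((a + l - r) %% l == b).
Proof.
move=> al bl rl.
have m2 x : x < l + l -> x %% l = if x < l then x else x - l.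
  move=> xl; case: ltnP => h; first by rewrite modn_small.
  by rewrite -{1}(subnK h) modnDr modn_small //; lia.
by rewrite !m2; [|lia|lia]; case: ifP; case: ifP; lia.
Qed.

(** [mates] enumerates from the side of [u]; this symmetric description identifies it with the graph
    of edges inside blocks. *)
Lemma mem_mates u x : (x \in N2 u) = (pair_query e u x != 0) && (blk sh l x == blk sh l u).
Proof.
rewrite mem_filter; case: eqP => //= /eqP /pair_query_neq0[vu vx].
rewrite /blk -mod_shift ?blk_lt ?ltn_mod // -/(blk sh l u).
have x0 : 0 < x by move: vx; rewrite /vname; lia.
apply/mapP/eqP => [[g _ ->]|ex].
  rewrite /mate addn1 subn1 /= divnMDl // modnMDl modn_mod.
  by rewrite (divn_small (ltn_pmod _ l0)) addn0.
exists ((x - 1) %/ l).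
  by rewrite mem_iota /= add0n ltn_divLR //; move: vx; rewrite /vname; lia.
by rewrite /mate -ex -divn_eq; lia.
Qed.

Lemma mates_range v x : vname n v -> x \in N2 v -> vname n x.
Proof. by rewrite mem_mates => _ /andP[/pair_query_neq0[]]. Qed.

Lemma mates_sym v x : vname n v -> vname n x -> count_mem x (N2 v) = count_mem v (N2 x).
Proof.
by move=> _ _; apply: count_mem_sym (mates_uniq _) (mates_uniq _) _;
  rewrite !mem_mates pair_query_sym [blk sh l x == _]eq_sym.
Qed.

Lemma mates_irr v : v \notin N2 v.
Proof. by rewrite mem_mates pair_query_irr. Qed.

Lemma mates_size v : vname n v -> size (N2 v) <= n.
Proof. by move=> vv; apply: size_names (mates_uniq _) _ => x; apply: mates_range. Qed.

Lemma mates_total : \sum_(1 <= z < n.+1) size (N2 z) <= n * gam.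
Proof.
apply: (leq_trans (n := \sum_(1 <= z < n.+1) gam)); last first.
  by rewrite sum_nat_const_nat subn1.
apply: leq_sum => z _; rewrite size_filter; apply: leq_trans (count_size _ _) _.
by rewrite size_map size_iota.
Qed.

End Mates.

Variable D : nat.

Let q := qlog D n.
Let l := 2 ^ q.
Let gam := n %/ l + 1.
Let M := 2 * n * tau D q.

(** Peeling and coloring need [2 * total + 2 * n], with [total] at most [M] or at most [n * gam];
    this also covers the other loops, and the final 1 makes the bound positive. *)
Definition fuel_bound : nat := 2 * (M + n * gam) + 2 * n + 1.
(** Besides counters, the memory holds colors up to [n.+1 * l] and names up to
    [gam * l <= n + l]. *)
Definition value_bound : nat := fuel_bound + n.+2 * (l + 2).
Definition time_bound : nat :=
  kost (coloring_prog (2 ^ D)) * (bitlen value_bound * fuel_bound).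

Definition shifts (w : nat -> bool) (g : nat) : nat := coin_val w (g * q) q.

(** Holds for every coin sequence; in the dense outcome randomness survives only in [shifts w]. *)
Lemma prog_spec w : exists s, [/\ run e adj (coloring_prog (2 ^ D)) w s,
  st_time s <= time_bound &
  (exists kk, coloring_of n 1 N (fun=> 0) kk (st_mem s aOut)) \/
  (M <= \sum_(1 <= z < n.+1) size (N z) /\
   exists kk, coloring_of n l (fun u => mates (pair_query e) (shifts w) l u gam)
     (blk (shifts w) l) kk (st_mem s aOut))].
Proof.
pose F := fuel_bound; pose B := value_bound.
pose pq := pair_query e; pose nq := nbr_query adj.
have F0 : 0 < F by rewrite /F /fuel_bound addn1.
have FB : F <= B by rewrite /B /value_bound leq_addr.
have l0 : 0 < l by rewrite expn_gt0.
have qn : q <= n := qlog_leq D n.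
have lq : n < gam * l by rewrite /gam addn1; apply: ltn_ceil.
have gl : gam * l <= n + l by rewrite /gam mulnDl mul1n leq_add2r leq_divM.
have BE : B = 2 * (M + n * gam) + 2 * n + 1 + n.+2 * (l + 2) by [].
have FE : F = 2 * (M + n * gam) + 2 * n + 1 by [].
have pqB u v : pq u v <= B by apply: leq_trans (pair_query_le u v) _; nia.
have nqB u v : nq u v <= B by apply: leq_trans (nbr_query_le u v) _; nia.
have g1 : 0 < gam by rewrite /gam addn1.
have gq : gam * q <= n * gam by rewrite mulnC leq_mul2r qn orbT.
have gn : gam <= n + 1 by rewrite /gam leq_add2r leq_div.
have nl : n.+1 * l <= B by nia.
have n2B : n.+2 <= B by nia.
(* Arrays that must still be blank: [zc] before the coloring, [z1] until the reading is over, [z0]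
   at the start. In the sparse outcome the blank [aBlk] provides the single block 0. *)
pose zc := [:: aHt; aDeg; aRem; aCnt; aK; aEnd; aCol; aMark].
pose z1 := [:: aI; aShift; aG; aBlk] ++ zc.
pose z0 := [:: aP; aStart] ++ z1.
pose N2 u := mates pq (shifts w) l u gam.
pose ready lb (Nf : nat -> seq nat) bl (m : memory) (k : nat) :=
  [/\ bounded B m, m aN 0 = n /\ m aL 0 = lb, stored n Nf m,
       forall y, vname n y -> m aBlk y = bl y & zero_on zc m].
pose post (m : memory) (k : nat) := (exists kk, coloring_of n 1 N (fun=> 0) kk (m aOut)) \/
  (M <= \sum_(1 <= z < n.+1) size (N z) /\
   exists kk, coloring_of n l N2 (blk (shifts w) l) kk (m aOut)).
have zero_frame Z c (m m' : memory) : (forall a, a \in Z -> a \notin writes c) ->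
    (forall a, a \notin writes c -> forall i, m' a i = m a i) -> zero_on Z m -> zero_on Z m'.
  by move=> hZ fr hz a i aZ; rewrite fr ?hz // hZ.
pose Phi0 (m : memory) := m aN 0 = n /\ zero_on z0 m.
pose Phi1 (m : memory) := [/\ m aN 0 = n, m aQ 0 = q, m aL 0 = l & m aGam 0 = gam]
  /\ zero_on z1 m.
pose Phi2 (m : memory) := [/\ m aN 0 = n, m aL 0 = l, m aGam 0 = gam & m aStart 1 = 0]
  /\ zero_on (aG :: zc) m.
pose Phi3 (m : memory) := m aN 0 = n /\ m aL 0 = l /\ zero_on zc m.
suff : triple pq nq w B F (fun m k => m = update (fun _ _ => 0) 0 0 n /\ k = 0)
    (coloring_prog (2 ^ D)) post.
  by move=> /(_ (input_state n)) []//= s [hs hp ht]; exists s; split.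
apply: (triple_seq F0 (Q := fun m k => [/\ bounded B m, m aN 0 = n, m aQ 0 = 0, m aL 0 = 1 & k = 0]
    /\ Phi0 m)).
  have hB0 : bounded B (update (fun _ _ => 0) 0 0 n) by apply: bounded_update => //; lia.
  apply: (triple_flat F0 pqB nqB) => // [m k [-> _]//|m k [-> ->]] /=; split.
    by split=> //; apply: bounded_update => //; lia.
  split=> // a i; rewrite /update; case: (eqVneq a aL) => [->//|_].
  by case: (eqVneq a 0) => [->|].
have nB : n < B by lia.
have nF : n <= F by lia.
have /(triple_frame (Phi := Phi0)) Hs := setup_loop w D F0 pqB nqB nB nF.
apply: (triple_seq F0 (Hs _)).
  move=> m m' fr [hN hz]; split; first by rewrite fr.
  by apply: zero_frame fr hz; apply/allP.
apply: (triple_seq F0 (Q := fun m k => [/\ bounded B m, m aN 0 = n, m aM 0 = M, k = 0 &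
       [/\ m aU 0 = 1, m aP 0 = 0 & m aStart 1 = 0]] /\ Phi1 m)).
  apply: (triple_flat F0 pqB nqB) => // [m k [[]]//|m k [[hB hQ hL hk] [hN hz]]] /=.
  rewrite /update /= hN hQ hL -/q -/l -/(tau D q) -/M -/gam; split.
    split=> //=; last by split=> //; apply: hz.
    by move=> a i /=; do !case: ifP => _ //; nia.
  split=> //= a i hZ; have hZ0 : a \in z0 by rewrite mem_cat hZ orbT.
  case: (eqVneq a aU) hZ => [->//|_]; case: (eqVneq a aGam) => [->//|_].
  by case: (eqVneq a aM) => [->//|_] _; apply: hz.
have MB : M <= B by lia.
have MF : M + n <= F by nia.
have /(triple_frame (Phi := Phi1)) Hr :=
  read_loop w F0 pqB nqB nB MB MF nbr_names_query nbr_names_pos.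
apply: (triple_seq F0 (Hr _)).
  move=> m m' fr [[hN hQ hL hG] hz]; split; first by rewrite !fr.
  by apply: zero_frame fr hz; apply/allP.
have sub1 : {subset zc <= z1} by move=> a ha'; rewrite mem_cat ha' orbT.
apply: (triple_seq F0 (Q := fun m k =>
    (\sum_(1 <= z < n.+1) size (N z) <= M /\ ready 1 N (fun=> 0) m k) \/
    (M <= \sum_(1 <= z < n.+1) size (N z) /\ ready l N2 (blk (shifts w) l) m k))).
  apply: (triple_if F0) => [m k [[]]//||]; last first.
    apply: (triple_flat F0 pqB nqB) => //
      [m k [[[]]]//|m k [[[hB hk hr] [[hN hQ hL hG] hz]] /= hU]].
    left; case: hr => [[eU [hacq hP]]|[hU' _ _]]; last first.
      by move: hU; rewrite hN addn1 ltnS hU'.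
    have [_ _ hP' _ _] := hacq; rewrite addn0 in hP'; split; first by rewrite -hP'.
    split=> //=.
    - by apply: bounded_update => //; lia.
    - by apply: acquired_stored; case: hacq.
    - by move=> y _; apply: hz.
    - move=> a i ha'; rewrite /update; case: (eqVneq a aL) ha' => [->//|_ ha'].
      exact: hz (sub1 _ ha').
  apply: triple_conseq (_ : triple pq nq w B F (fun m k => (M <= \sum_(1 <= z < n.+1) size (N z)) /\
      ([/\ bounded B m, m aQ 0 = q, m aGam 0 = gam, k = 0 &
       m aI 0 = 0 /\ forall g, m aShift g = 0] /\ Phi2 m)) random_part
      (fun m k => (M <= \sum_(1 <= z < n.+1) size (N z)) /\
         ready l N2 (blk (shifts w) l) m k)) => //.
  - move=> m k [[[hB hk hr] [[hN hQ hL hG] hz]] /= hU].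
    have hUn : m aU 0 <= n by move: hU; rewrite hN addn1 ltnS; case: leqP.
    case: hr => [[eU _]|[_ hS hM]]; first by lia.
    split=> //; split; first by split=> //; split=> [|g]; apply: hz.
    split=> // a i; rewrite inE => /orP[/eqP ->|ha']; apply: hz => //.
    exact: sub1.
  - by move=> m k h; right.
  case: (leqP M (\sum_(1 <= z < n.+1) size (N z))) => hM; last by move=> s [].
  have lB : l <= B by nia.
  have gqB : gam * q <= B by lia.
  have gqF : gam * q <= F by lia.
  have /(triple_frame (Phi := Phi2)) Ht := toss_loop w F0 pqB nqB lB gqB gqF.
  apply: triple_conseq (_ : triple pq nq w B F _ _ (ready l N2 (blk (shifts w) l))).
  - by move=> m k [_ H]; exact: H.
  - by [].
  apply: (triple_seq F0 (Ht _)).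
    move=> m m' fr [[hN hL hG hS] hz]; split; first by rewrite !fr.
    by apply: zero_frame fr hz; apply/allP.
  apply: (triple_seq F0 (Q := fun m k => [/\ bounded B m,
       [/\ m aN 0 = n, m aL 0 = l & m aGam 0 = gam],
       [/\ m aU 0 = 1, m aP 0 = 0, m aG 0 = 0 & m aStart 1 = 0]
       & forall g, g < gam -> m aShift g = shifts w g] /\ Phi3 m)).
    apply: (triple_flat F0 pqB nqB) => // [m k [[]]//|m k [[hB hsh] [[hN hL hG hS] hz]]] /=.
    rewrite /update /=; split.
      split=> //=; last by split=> //; apply: hz.
      by move=> a i /=; do !case: ifP => _ //; lia.
    split=> //; split=> // a i ha' /=.
    case: (eqVneq a aP) ha' => [->//|_]; case: (eqVneq a aU) => [->//|_] ha'.
    by apply: hz; rewrite inE ha' orbT.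
  have glB : gam * l <= B by nia.
  have ngB : n * gam <= B by lia.
  have gB : gam <= B by lia.
  have ngF : n * gam.+1 <= F by nia.
  have /(triple_frame (Phi := Phi3)) Hp := @pair_loop pq nq w B F n l gam (shifts w) F0
    pqB nqB nB l0 lB glB ngB gB ngF g1 lq.
  apply: triple_conseq (Hp _) => //.
  - move=> m k [[hB hacq hP hb] [hN [hL hz]]]; split=> //.
    exact: acquired_stored.
  - move=> m m' fr [hN [hL hz]]; split; first by rewrite fr.
    by split; [rewrite fr | apply: zero_frame fr hz; apply/allP].
apply: triple_or.
- case: (leqP (\sum_(1 <= z < n.+1) size (N z)) M) => hM; last by move=> s [].
  have tF : 2 * (\sum_(1 <= z < n.+1) size (N z)) + 2 * n <= F by nia.
  have n1B : n.+1 * 1 <= B by lia.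
  apply: triple_conseq (coloring_part_spec w F0 pqB nqB FB n2B n1B nbr_names_range
    nbr_names_sym nbr_names_irr nbr_names_size tF (bl := fun=> 0) _) => //.
  + by move=> m k [].
  + by move=> m k [kk h]; left; exists kk.
- have sl g : shifts w g < l by apply: coin_val_lt.
  have tF : 2 * (\sum_(1 <= z < n.+1) size (N2 z)) + 2 * n <= F.
    have hm : \sum_(1 <= z < n.+1) size (N2 z) <= n * gam := mates_total _ _ _.
    by rewrite FE; lia.
  case: (leqP M (\sum_(1 <= z < n.+1) size (N z))) => hM; last by move=> s [].
  apply: triple_conseq (coloring_part_spec w F0 pqB nqB FB n2B nl (mates_range l0 sl lq)
    (mates_sym l0 sl lq) (mates_irr l0 sl lq) (mates_size l0 sl lq) tF _).
  + by move=> m k [_]; apply.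
  + by move=> m k h; right.
  + by move=> y _; apply: blk_lt.
Qed.

End Names.

(** * Degeneracy orders *)

(** The order found by the program depends on the coins; the Chernoff bound needs one fixed in
    advance. It arises by removing low-degree vertices one at a time, each getting the least rank
    among those left. *)
Lemma degenerate_rank (V : finType) (e : rel V) k : degenerate e k ->
  exists rk : V -> nat, injective rk /\
    forall u, #|[set v | e u v && (rk u < rk v)]| <= k.
Proof.
move=> /forallP hd.
suff gen (N : nat) (S : {set V}) : #|S| < N ->
    exists rk : V -> nat, {in S &, injective rk} /\
    forall u, u \in S -> #|[set v in S | e u v && (rk u < rk v)]| <= k.
  have [rk [inj hrk]] := gen _ [set: V] (ltnSn _).
  exists rk; split=> [u v|u]; first by apply: inj; rewrite inE.
  apply: leq_trans (hrk u _); rewrite ?inE //; apply: subset_leq_card.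
  by apply/fintype.subsetP => v; rewrite !inE.
elim: N S => // N IH S hS.
have [->|S0] := eqVneq S finset.set0.
  by exists (fun=> 0); split=> u; rewrite inE.
have := hd S; rewrite S0 => /existsP[u /andP[uS hu]].
have [|rk [inj hrk]] := IH (S :\ u); first by rewrite (cardsD1 u) uS in hS; lia.
exists (fun v => if v == u then 0 else (rk v).+1); split.
  move=> x y xS yS; case: (eqVneq x u) => [->|nx]; case: (eqVneq y u) => [->|ny] //.
  by move=> [] /inj; apply; rewrite !inE ?nx ?ny.
move=> x xS; case: (eqVneq x u) => [->|nx].
  apply: leq_trans hu; apply: subset_leq_card; apply/fintype.subsetP => v; rewrite !inE.
  by case/and3P=> -> ->.
apply: leq_trans (hrk x _); last by rewrite !inE nx.
apply: subset_leq_card; apply/fintype.subsetP => v; rewrite !inE.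
by case: (eqVneq v u) => [_|nv] /=; rewrite ?ltn0 ?andbF //= -andbA.
Qed.

Section Rank.
Variables (n : nat) (e : rel 'I_n) (adj : 'I_n -> seq 'I_n).
Hypotheses (ge : simple_graph e) (ha : adjacency_lists e adj).

Lemma count_adj u (a : pred 'I_n) : count a (adj u) = #|[set v | a v & e u v]|.
Proof.
have [hu hm] := ha u; rewrite -size_filter -(card_uniqP (filter_uniq a hu)).
by apply: eq_card => v; rewrite mem_filter hm inE.
Qed.

Lemma count_nbr_names (u : 'I_n) (S : pred nat) :
  count S (nbr_names adj u.+1) = #|[set v : 'I_n | S v.+1 & e u v]|.
Proof. by rewrite /nbr_names vertex_succ count_map count_adj. Qed.

Lemma degN_nbr_names k : degenerate e k -> degN n (nbr_names adj) k.
Proof.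
move=> /forallP hd S [v /vertexP[x _ ->] Sx].
have := hd [set y : 'I_n | S y.+1]; case: eqP => [h|_ /=].
  by have := finset.in_set0 x; rewrite -h inE Sx.
move=> /existsP[u]; rewrite inE => /andP[Su hu].
exists u.+1; split; [exact: ltn_ord | by [] |]; rewrite count_nbr_names; apply: leq_trans hu.
by apply: subset_leq_card; apply/fintype.subsetP => y; rewrite !inE.
Qed.

(** Orienting edges upward in rank gives at most [k * n] of them, and each is counted at both ends.
    Against the budget [2 * n * tau] this yields [tau <= k]. *)
Lemma sum_size_adj k : degenerate e k ->
  \sum_(1 <= z < n.+1) size (nbr_names adj z) <= 2 * k * n.
Proof.
case: ge => sym irr /degenerate_rank[rk [inj hrk]].
rewrite big_add1 /= big_mkord.
rewrite (eq_bigr (fun u : 'I_n => \sum_v (e u v && (rk u < rk v)) +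
                                  \sum_v (e u v && (rk v < rk u)))); last first.
  move=> u _; rewrite -(count_predT (nbr_names _ _)) count_nbr_names.
  rewrite -sum1_card big_mkcond /= -big_split /=; apply: eq_bigr => v _; rewrite inE /=.
  case: (eqVneq u v) => [->|nuv]; first by rewrite irr.
  by case: (e u v) => //=; case: ltngtP => // /inj h; rewrite h eqxx in nuv.
rewrite big_split /= [X in _ + X]exchange_big /=.
rewrite [X in _ + X](eq_bigr (fun u : 'I_n => \sum_v (e u v && (rk u < rk v)))); last first.
  by move=> u _; apply: eq_bigr => v _; rewrite sym.
rewrite addnn -mul2n -mulnA leq_mul2l /=.
apply: (leq_trans (n := \sum_(u < n) k)); last by rewrite sum_nat_const card_ord mulnC.
apply: leq_sum => u _; apply: leq_trans (hrk u); rewrite -sum1_card big_mkcond /=.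
by rewrite [X in _ <= X]big_mkcond /=; apply: leq_sum => v _; rewrite inE; case: (_ && _).
Qed.

(* Extended by [false] outside the vertices, since the last group may overshoot [n]. *)
Definition later (rk : 'I_n -> nat) (u : 'I_n) : pred nat :=
  fun x => [exists y : 'I_n, [&& y == x :> nat, e u y & rk u < rk y]].

Lemma count_later rk u k s : #|[set v | e u v && (rk u < rk v)]| <= k -> uniq s ->
  count (later rk u) s <= k.
Proof.
move=> hk us; apply: leq_trans hk; rewrite -size_filter cardE.
rewrite -(size_map val); apply: uniq_leq_size; first exact: filter_uniq.
move=> x; rewrite mem_filter => /andP[/existsP[y /and3P[/eqP <- h1 h2]] _].
by apply/mapP; exists y => //; rewrite mem_enum inE h1 h2.
Qed.

(** The label [b] is a parameter and not the block of some vertex, which would depend on the shifts.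
    Vertices are numbered from 0 here. *)
Definition block_count (a : pred nat) (l gam b : nat) (sh : nat -> nat) : nat :=
  count (fun g => a (g * l + (b + sh g) %% l)) (iota 0 gam).

(** In any set of vertices the one of least rank has only later neighbors; those in its block are
    counted by [block_count] at its own label. *)
Lemma degN_mates rk sh l gam d : injective rk -> 0 < l -> n < gam * l ->
  (forall g, sh g < l) ->
  (forall (u : 'I_n) b, b < l -> block_count (later rk u) l gam b sh <= d) ->
  degN n (fun u => mates (pair_query e) sh l u gam) d.
Proof.
move=> inj l0 lq shl hd S [v /vertexP[x _ ->] Sx].
case: (@arg_minnP _ x (fun y : 'I_n => S y.+1) rk Sx) => u Su umin.
exists u.+1; split; [exact: ltn_ord | by [] |].
apply: leq_trans (hd u (blk sh l u.+1) (blk_lt sh l0 u.+1)).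
rewrite /mates count_filter count_map /block_count; apply: sub_count => g /= /andP[Sg pg].
have [_ /vertexP[y hy ey]] := pair_query_neq0 pg.
move: pg Sg; rewrite /pair_query hy vertex_succ ey => pg Sy.
have exy : e u y by case: (e u y) pg.
apply/existsP; exists y; rewrite exy /= ltn_neqAle umin // andbT; apply/andP; split.
  by move: ey; rewrite /mate addn1 => -[->].
by apply/eqP => /inj euy; case: ge => _ irr; rewrite euy irr in exy.
Qed.

End Rank.

Local Open Scope ring_scope.

(** * A Chernoff bound for shifted blocks *)

Section CoinExpectation.
Variable R : realType.

Definition coin_mean (m : nat) (f : (nat -> bool) -> R) : R :=
  (\sum_(r : m.-tuple bool) f (coin_stream r)) / 2 ^+ m.

Definition coin_cons (b : bool) (w : nat -> bool) : nat -> bool :=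
  fun i => if i is j.+1 then w j else b.

Lemma coin_prob_mean m (E : (nat -> bool) -> Prop) :
  coin_prob R m E = coin_mean m (fun w => (`[< E w >])%:R).
Proof.
rewrite /coin_prob /coin_mean; congr (_ / _).
rewrite -sum1_card natr_sum [RHS]big_mkcond [LHS]big_mkcond /=.
by apply: eq_bigr => r _; rewrite inE; case: asboolP.
Qed.

Lemma coin_mean_le m f g : (forall w, f w <= g w) -> coin_mean m f <= coin_mean m g.
Proof.
move=> h; rewrite /coin_mean ler_pM2r ?invr_gt0 ?exprn_gt0 ?ltr0n //.
by apply: ler_sum => r _; apply: h.
Qed.

Lemma coin_mean_sum (I : finType) m (f : I -> (nat -> bool) -> R) :
  coin_mean m (fun w => \sum_i f i w) = \sum_i coin_mean m (f i).
Proof. by rewrite /coin_mean exchange_big /= mulr_suml. Qed.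

Lemma coin_meanZ m c f : coin_mean m (fun w => c * f w) = c * coin_mean m f.
Proof. by rewrite /coin_mean -mulr_sumr mulrA. Qed.

Lemma coin_mean_cst m c : coin_mean m (fun=> c) = c.
Proof.
rewrite /coin_mean sumr_const card_tuple card_bool -[c *+ _]mulr_natr natrX mulfK //.
Qed.

Lemma coin_meanS m f :
  coin_mean m.+1 f = \sum_(b : bool) coin_mean m (fun w => f (coin_cons b w)) / 2.
Proof.
rewrite /coin_mean -!mulr_suml exprS invfM [2^-1 * _]mulrC mulrA; congr (_ / _ / _).
rewrite pair_bigA /= (reindex (fun p : bool * m.-tuple bool => cons_tuple p.1 p.2)) /=.
  apply: eq_bigr => p _; congr f; apply/funext => -[|i] //.
exists (fun r : m.+1.-tuple bool => (thead r, behead_tuple r)) => r _ /=.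
  by case: r => b r; congr pair; apply: val_inj.
by rewrite [RHS]tuple_eta; apply: val_inj.
Qed.

Lemma coin_valE w s j : coin_val w s j = coin_val (fun i => w (s + i)%N) 0 j.
Proof. by elim: j => //= j ->. Qed.

Lemma coin_valS w j :
  coin_val w 0 j.+1 = (w 0%N * 2 ^ j + coin_val (fun i => w i.+1) 0 j)%N.
Proof.
elim: j => [|j IH]; first by rewrite /= !addn0 muln1.
rewrite -[LHS]/(2 * coin_val w 0 j.+1 + w j.+1)%N IH /= expnS !add0n mulnDr mulnCA; lia.
Qed.

Lemma sum_exp2S j (h : nat -> R) : \sum_(x < 2 ^ j.+1) h x =
  \sum_(b : bool) \sum_(x < 2 ^ j) h (b * 2 ^ j + x)%N.
Proof.
by rewrite big_bool /= mul1n mul0n addrC expnS mul2n -addnn big_split_ord.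
Qed.

(** The first [q] coins form a uniform number below [2 ^ q] that is independent of the other coins,
    so the mean of a product factors. *)
Lemma coin_mean_prefix q m (h : nat -> R) g :
  coin_mean (q + m) (fun w => h (coin_val w 0 q) * g (fun i => w (q + i)%N)) =
  (\sum_(x < 2 ^ q) h x) / 2 ^+ q * coin_mean m g.
Proof.
elim: q h => [|q IH] h.
  by rewrite big_ord1 expr0 divr1 -coin_meanZ.
rewrite addSn coin_meanS.
rewrite (eq_bigr (fun b : bool =>
  (\sum_(x < 2 ^ q) h (b * 2 ^ q + x)%N) / 2 ^+ q * coin_mean m g / 2)).
  by rewrite sum_exp2S -!big_distrl /= exprS; field; rewrite expf_neq0 ?pnatr_eq0.
move=> b _; rewrite -(IH (fun x => h (b * 2 ^ q + x)%N)); congr (coin_mean _ _ / _).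
apply/funext => w.
by rewrite coin_valS.
Qed.

Lemma coin_mean_blocks q G m (phi : nat -> nat -> R) :
  coin_mean (G * q + m) (fun w => \prod_(g < G) phi g (coin_val w (g * q) q)) =
  \prod_(g < G) ((\sum_(x < 2 ^ q) phi g x) / 2 ^+ q).
Proof.
elim: G phi => [|G IH] phi.
  rewrite big_ord0 -[RHS](coin_mean_cst (0 * q + m)); congr coin_mean.
  by apply/funext => w; rewrite big_ord0.
rewrite big_ord_recl -(IH (fun g => phi g.+1)) -coin_mean_prefix mulSn -addnA.
congr coin_mean; apply/funext => w; rewrite big_ord_recl mul0n; congr (_ * _).
apply: eq_bigr => g _; rewrite coin_valE [in RHS]coin_valE; congr (phi _ (coin_val _ _ _)).
by apply/funext => i; rewrite addnA -mulSn.
Qed.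

Lemma sum_mod_shift l b (f : nat -> R) : (0 < l)%N ->
  \sum_(x < l) f ((b + x) %% l)%N = \sum_(x < l) f x.
Proof.
case: l => // l _; pose s (x : 'I_l.+1) : 'I_l.+1 := Ordinal (ltn_pmod (b + x) (ltn0Sn l)).
rewrite [RHS](reindex_inj (h := s)) //= => x y /(congr1 val) /= /eqP.
by rewrite eqn_modDl !modn_small // => /eqP /val_inj.
Qed.

Lemma sum_blocks l G (f : nat -> R) :
  \sum_(g < G) \sum_(x < l) f (g * l + x)%N = \sum_(x < G * l) f x.
Proof.
elim: G => [|G IH]; first by rewrite mul0n !big_ord0.
by rewrite big_ord_recr /= IH mulSn addnC big_split_ord.
Qed.

(** From [exp (- x) >= 1 - x] comes [exp x <= 1 / (1 - x)], which lies below the quadratic on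
    [[0, 1/2]]. *)
Lemma expR_le_quad (x : R) : 0 <= x <= 2^-1 -> expR x <= 1 + x + 2 * x ^+ 2.
Proof.
move=> /andP[x0 x1]; have h := expR_ge1Dx (- x).
have h1 : 0 < 1 - x by lra.
rewrite -[x in expR x]opprK expRN; apply: (@le_trans _ _ (1 - x)^-1).
  by rewrite lef_pV2 ?posrE ?expR_gt0.
rewrite -[leLHS]mul1r ler_pdivrMr //; nra.
Qed.

(** Markov's inequality for [y ^ X] with [y = exp eps]. Since [y - 1 <= eps + 2 * eps ^ 2], the
    slack [3 * eps] in the threshold leaves [- eps ^ 2] in the exponent. *)
Lemma block_count_tail q G m (a : pred nat) (b K d : nat) (eps : R) :
  (count a (iota 0 (G * 2 ^ q)) <= K)%N -> 0 <= eps <= 2^-1 ->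
  (1 + 3 * eps) * K%:R / 2 ^+ q <= d.+1%:R ->
  coin_mean (G * q + m) (fun w => (d < block_count a (2 ^ q) G b
     (fun g => coin_val w (g * q) q))%N%:R) <= expR (- (eps ^+ 2 * K%:R / 2 ^+ q)).
Proof.
move=> hK heps hd; set y := expR eps; set l := (2 ^ q)%N.
have /andP[e0 e1] := heps.
have l0 : (0 < l)%N by rewrite expn_gt0.
have lR : (l%:R : R) = 2 ^+ q by rewrite natrX.
have lp : 0 < (2 : R) ^+ q by rewrite exprn_gt0.
have y1 : 1 <= y by rewrite -expR0 ler_expR.
pose phi g x : R := if a (g * l + (b + x) %% l)%N then y else 1.
have prodE (sh : nat -> nat) : \prod_(g < G) phi g (sh g) = y ^+ block_count a l G b sh.
  rewrite /block_count -(big_mkord xpredT (fun g => phi g (sh g))) /index_iota subn0.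
  elim: (iota 0 G) => [|g s IH]; first by rewrite big_nil expr0.
  by rewrite big_cons IH /= exprD /phi; case: (a _).
have markov w : (d < block_count a l G b (fun g => coin_val w (g * q) q))%N%:R <=
    y ^- d.+1 * \prod_(g < G) phi g (coin_val w (g * q) q).
  rewrite (prodE (fun g => coin_val w (g * q) q)); set X := block_count _ _ _ _ _.
  have yX : 0 <= y ^- d.+1 * y ^+ X.
    by rewrite mulr_ge0 ?invr_ge0 ?exprn_ge0 // (le_trans _ y1).
  case: ltnP => // hX; rewrite ler_pdivlMl ?mulr1 ?exprn_gt0 ?(lt_le_trans _ y1) //.
  by rewrite ler_weXn2l.
apply: le_trans (coin_mean_le _ markov) _; rewrite coin_meanZ coin_mean_blocks.
pose cnt g : R := \sum_(x < l) (a (g * l + x)%N)%:R.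
(* A uniform shift runs through the whole group, whatever [b] is. *)
have avg (g : nat) : (\sum_(x < l) phi g x) / 2 ^+ q = 1 + (y - 1) * cnt g / 2 ^+ q.
  rewrite /phi (sum_mod_shift b (fun x => if a (g * l + x)%N then y else 1) l0).
  rewrite (eq_bigr (fun x : 'I_l => 1 + (y - 1) * (a (g * l + x)%N)%:R)); last first.
    by move=> x _; case: (a _); rewrite ?mulr1 ?mulr0 ?addr0 // addrC subrK.
  rewrite big_split /= sumr_const card_ord -mulr_sumr -/(cnt g) mulrDl lR divff //.
have avg_le (g : nat) : 0 <= (\sum_(x < l) phi g x) / 2 ^+ q <= expR ((y - 1) * cnt g / 2 ^+ q).
  rewrite divr_ge0 /=; last 2 first.
  - by apply: sumr_ge0 => x _; rewrite /phi; case: ifP => _; rewrite ?ler01 // (le_trans _ y1).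
  - exact: ltW.
  by rewrite avg expR_ge1Dx.
have prod_le : \prod_(g < G) ((\sum_(x < l) phi g x) / 2 ^+ q) <= expR ((y - 1) * K%:R / 2 ^+ q).
  apply: (@le_trans _ _ (\prod_(g < G) expR ((y - 1) * cnt g / 2 ^+ q))).
    by apply: ler_prod => g _; apply: avg_le.
  rewrite -expR_sum ler_expR -mulr_suml -mulr_sumr ler_pM2r ?invr_gt0 //.
  rewrite ler_wpM2l ?subr_ge0 //.
  (* The groups partition the numbers below [G * l], so the group counts add up to at most [K]. *)
  rewrite /cnt (sum_blocks l G (fun x => (a x)%:R)) -natr_sum ler_nat.
  apply: leq_trans hK; rewrite -sum1_count big_mkcond /= -/l.
  rewrite -(big_mkord xpredT (fun x => nat_of_bool (a x))) /index_iota subn0.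
  by rewrite [leqRHS]big_mkcond /=; apply: leq_sum => x _; case: (a x).
have hy : y - 1 <= eps + 2 * eps ^+ 2.
  by have := expR_le_quad heps; rewrite -/y; lra.
apply: le_trans (ler_wpM2l _ prod_le) _; first by rewrite invr_ge0 exprn_ge0 // (le_trans _ y1).
rewrite -[y ^+ _]expRM_natl -expRN -expRD ler_expR.
have KR : 0 <= (K%:R : R) / 2 ^+ q by rewrite divr_ge0 // ltW.
have h1 : (y - 1) * K%:R / 2 ^+ q <= (eps + 2 * eps ^+ 2) * (K%:R / 2 ^+ q).
  by rewrite -mulrA ler_wpM2r.
have h2 : eps * ((1 + 3 * eps) * K%:R / 2 ^+ q) <= d.+1%:R * eps.
  by rewrite [leRHS]mulrC ler_wpM2l.
move: h1 h2; rewrite -!mulrA; move: (K%:R / 2 ^+ q) => z.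
lra.
Qed.

End CoinExpectation.

Local Open Scope nat_scope.

(** * Success of the program *)

Lemma num_colors_le (V : finType) (col : V -> nat) b :
  (forall u, col u < b) -> num_colors col <= b.
Proof.
move=> h; rewrite /num_colors -[leqRHS](size_iota 0).
apply: uniq_leq_size (undup_uniq _) _ => x; rewrite mem_undup => /codomP[u ->].
by rewrite mem_iota /= add0n.
Qed.

(** A function of [k] alone that dominates the loss [2 * k %/ qlog D n] for every [n >= k]; the
    added 1 covers the [k + 1] colors of greedy coloring. The case [qlog D k = 0] concerns only
    small [k]. *)
Definition surplus (D k : nat) : nat :=
  if qlog D k == 0 then 2 * k + 1 else 2 * k %/ qlog D k + 1.

Lemma surplus_ge D k n : k <= n -> 0 < qlog D n -> 2 * k %/ qlog D n <= surplus D k.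
Proof.
move=> kn q0; have qq := qlog_mono D kn; rewrite /surplus; case: posnP => qk.
  by apply: leq_trans (leq_div _ _) _; rewrite addn1.
by apply: leq_trans (leq_div2l _ qk qq) _; rewrite addn1.
Qed.

Lemma surplus_gt0 D k : 0 < surplus D k.
Proof. by rewrite /surplus; case: ifP; rewrite addn1. Qed.

Lemma degenerate_degeneracy (V : finType) (e : rel V) : degenerate e (degeneracy e).
Proof. by rewrite /degeneracy; case: ex_minnP. Qed.

Lemma degeneracy_leq_card (V : finType) (e : rel V) : degeneracy e <= #|V|.
Proof.
rewrite /degeneracy; case: ex_minnP => k _; apply.
apply/forallP => S; apply/implyP => /set0Pn[u Su].
by apply/existsP; exists u; rewrite Su max_card.
Qed.

Section Success.
Variables (n : nat) (e : rel 'I_n) (adj : 'I_n -> seq 'I_n) (D : nat).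
Hypotheses (n0 : 0 < n) (ge : simple_graph e) (ha : adjacency_lists e adj).

Let q := qlog D n.
Let l := 2 ^ q.
Let gam := n %/ l + 1.
Let k := degeneracy e.

Definition success (w : nat -> bool) : Prop :=
  exists s, [/\ run e adj (coloring_prog (2 ^ D)) w s,
    proper_coloring e (@output_coloring n s) &
    num_colors (@output_coloring n s) <= k + surplus D k].

Lemma group_bound : n < gam * l.
Proof. by rewrite /gam addn1; apply: ltn_ceil; rewrite expn_gt0. Qed.

(** Adjacent vertices in different blocks have colors that differ mod [lb]; inside a block the lists
    decide. Since [kk <= d], all colors are below [lb * d.+1]. *)
Lemma coloring_success w s lb N bl kk d :
  run e adj (coloring_prog (2 ^ D)) w s ->
  coloring_of n lb N bl kk (st_mem s 1) ->
  (forall x y : 'I_n, e x y -> bl x.+1 = bl y.+1 -> y.+1 \in N x.+1) ->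
  (forall x, bl x < lb) -> degN n N d -> lb * d.+1 <= k + surplus D k -> success w.
Proof.
move=> hs [hkk hout hprop] hN hbl hd hle; exists s; split=> //.
  move=> u v euv; have vu : vname n u.+1 := ltn_ord u; have vv : vname n v.+1 := ltn_ord v.
  case: (eqVneq (bl u.+1) (bl v.+1)) => [eb|/eqP nb].
    by apply/nesym; apply: hprop vu _ (esym eb); apply: hN.
  have [cu eu _] := hout _ vu; have [cv ev _] := hout _ vv.
  rewrite /output_coloring eu ev => /(congr1 (fun x => x %% lb)).
  by rewrite !modnMDl !modn_small.
apply: leq_trans hle; apply: num_colors_le => u.
have [c ec hc] := hout u.+1 (ltn_ord u); rewrite /output_coloring ec.
have := hbl u.+1; have := hkk _ hd => h1 h2.
have : c.+1 * lb <= d.+1 * lb by rewrite leq_mul2r; apply/orP; right; lia.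
by rewrite mulSn (mulnC lb); lia.
Qed.

Lemma success_or_dense w :
  success w \/ tau D q <= k /\ forall d, l * d.+1 <= k + surplus D k ->
    degN n (fun u => mates (pair_query e) (shifts n D w) l u gam) d -> success w.
Proof.
have hk : degenerate e k := degenerate_degeneracy e.
have [s [hs _ [[kk h]|[hM [kk h]]]]] := prog_spec ge ha D w.
  left; apply: (coloring_success hs h) (degN_nbr_names ha hk) _ => //.
    by move=> x y exy _; rewrite (mem_nbr_names ha) /pair_query !vertex_succ exy.
  by rewrite mul1n; have := surplus_gt0 D k; lia.
right; split.
  have := leq_trans hM (sum_size_adj ge ha hk); rewrite -/q -!mulnA leq_mul2l /=.
  by rewrite mulnC leq_pmul2r.
move=> d hle hd; apply: (coloring_success hs h _ _ hd hle).
  move=> x y exy eb; rewrite mem_mates ?expn_gt0 ?group_bound //.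
    by rewrite /pair_query !vertex_succ exy -/q -/l eb eqxx.
  by move=> g; apply: coin_val_lt.
by move=> x; rewrite ltn_mod expn_gt0.
Qed.

Definition block_degree : nat := k * q.+1 %/ (q * l).

Lemma block_degree_colors : 0 < q -> tau D q <= k ->
  l * block_degree.+1 <= k + surplus D k.
Proof.
move=> q0 hk; apply: leq_trans (_ : k + 2 * k %/ q <= _); last first.
  rewrite leq_add2l; apply: surplus_ge q0; have := degeneracy_leq_card e.
  by rewrite card_ord.
have l0 : 0 < l by rewrite expn_gt0.
rewrite -leq_subLR leq_divRL // mulnBl leq_subLR.
have h1 : block_degree * (q * l) <= k * q.+1 := leq_divM _ _.
(* Rounding up costs one color per block, [l] in all, and [q * l <= tau D q <= k] bounds this by
   [k / q]. *)
have h2 : q * l <= k.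
  apply: leq_trans hk; rewrite /tau -/l leq_mul2r; apply/orP; right.
  by rewrite -[leqLHS]mul1n; apply: leq_mul; [rewrite expn_gt0 | nia].
have -> : l * block_degree.+1 * q = block_degree * (q * l) + q * l by nia.
nia.
Qed.

Lemma success_of_blocks w rk d : injective rk -> tau D q <= k ->
  l * d.+1 <= k + surplus D k ->
  (forall (u : 'I_n) b, b < l -> block_count (later e rk u) l gam b (shifts n D w) <= d) ->
  success w.
Proof.
move=> inj hk hd hb; have [//|[_ h]] := success_or_dense w.
apply: h hd _; apply: (degN_mates ge inj) => //; first by rewrite expn_gt0.
  exact: group_bound.
by move=> g; apply: coin_val_lt.
Qed.

(** For [k < tau] the dense outcome is impossible. For [q = 0] the budget is 0 and certifies
    nothing, but then [l = 1] and the only block is the whole graph. *)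
Lemma success_sparse w : (q == 0) || (k < tau D q) -> success w.
Proof.
case/orP=> [/eqP q0|hk]; last by have [//|[]] := success_or_dense w; lia.
have [rk [inj hrk]] := degenerate_rank (degenerate_degeneracy e).
have l1 : l = 1 by rewrite /l q0.
have [//|[hk _]] := success_or_dense w.
apply: (@success_of_blocks w rk k inj hk).
  by rewrite l1 mul1n; have := surplus_gt0 D k; lia.
move=> u b _; rewrite /block_count l1.
rewrite (eq_count (a2 := later e rk u)) => [|g].
  by apply: count_later (iota_uniq _ _); apply: hrk.
by rewrite muln1 modn1 addn0.
Qed.

End Success.

Lemma kost_gt0 c : 0 < kost c.
Proof. by elim: c => //= *; lia. Qed.

Lemma fuel_leq_time n D : fuel_bound n D <= time_bound n D.
Proof.
rewrite /time_bound mulnA leq_pmull // muln_gt0 kost_gt0; exact: bitlen_gt0.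
Qed.

Lemma coins_leq_time n D : (n %/ 2 ^ qlog D n + 1) * qlog D n <= time_bound n D.
Proof.
apply: leq_trans (fuel_leq_time n D); rewrite /fuel_bound.
set g := n %/ _ + 1; have := qlog_leq D n; nia.
Qed.

(** The purpose of [D = c + 12]: the Chernoff exponent [2 ^ D * q / 9] must reach [c + 2] times the
    exponent [(2 * D + 10) * q] of [size_leq_exp]. *)
Lemma exponent_bound c : 9 * (2 * (c + 12) + 10) * (c + 2) <= 2 ^ (c + 12).
Proof. by elim: c => // c IH; rewrite addSn expnS; nia. Qed.

(** [n < tau D q.+1 ^ 2] and [q + 1 <= 2 ^ q] make [ln n] linear in [q]. *)
Lemma size_leq_exp D n : 0 < qlog D n -> n <= 2 ^ ((2 * D + 10) * qlog D n).
Proof.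
move=> q0; apply: leq_trans (ltnW (ltn_tau_qlog D n)) _; set q := qlog D n in q0 *.
have h : tau D q.+1 <= 2 ^ (D + 3 * q + q.+1).
  rewrite /tau !expnD; apply: leq_mul => //; apply: leq_mul => //.
  have hq := ltn_expl q (isT : 1 < 2); rewrite expn0 muln1 mulnA.
  by apply: leq_mul => //; apply: leq_mul.
apply: leq_trans (_ : (2 ^ (D + 3 * q + q.+1)) ^ 2 <= _); first by rewrite leq_exp2r.
by rewrite -expnM leq_exp2l //; nia.
Qed.

Local Open Scope ring_scope.

Section SuccessProbability.
Variables (R : realType) (c n : nat) (e : rel 'I_n) (adj : 'I_n -> seq 'I_n).
Hypotheses (n0 : (0 < n)%N) (ge : simple_graph e) (ha : adjacency_lists e adj).

Let D := (c + 12)%N.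

Lemma coin_meanD m (f g : (nat -> bool) -> R) :
  coin_mean m (fun w => f w + g w) = coin_mean m f + coin_mean m g.
Proof. by rewrite /coin_mean big_split /= mulrDl. Qed.

(* With [eps = 1 / (3 q)] the Chernoff exponent is at least [2 ^ D * q / 9]. *)
Lemma tail_bound : let q := qlog D n in (0 < q)%N -> (tau D q <= degeneracy e)%N ->
  (n%:R * (2 ^ q)%:R) * expR (- ((3 * q%:R)^-1 ^+ 2 * (degeneracy e)%:R / 2 ^+ q))
    <= (n%:R ^+ c)^-1 :> R.
Proof.
move=> q q0 hk; set k := degeneracy e in hk *.
have qR : 0 < (q%:R : R) by rewrite ltr0n.
have nR : 0 < (n%:R : R) by rewrite ltr0n.
have lR : 0 < (2 : R) ^+ q by rewrite exprn_gt0.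
have ln : (2 ^ q <= n)%N := exp2_qlog_leq_pos D n0.
have expo : (((2 * D + 10) * q * (c + 2))%N%:R : R) <= (3 * q%:R)^-1 ^+ 2 * k%:R / 2 ^+ q.
  apply: (@le_trans _ _ ((3 * q%:R)^-1 ^+ 2 * (tau D q)%:R / 2 ^+ q)); last first.
    rewrite ler_pM2r ?invr_gt0 // ler_wpM2l ?ler_nat //.
  have -> : (3 * q%:R)^-1 ^+ 2 * (tau D q)%:R / 2 ^+ q = (2 ^ D)%N%:R * q%:R / 9 :> R.
    rewrite /tau !natrM !natrX; field; apply/andP; split; rewrite gt_eqF //.
  rewrite ler_pdivlMr // -!natrM ler_nat; have := exponent_bound c; rewrite -/D; nia.
(* As [2 ^ q <= n], the union bound costs at most [n ^ 2], whence the exponent [c + 2]. *)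
apply: (@le_trans _ _ (n%:R ^+ 2 * expR (- ((2 * D + 10) * q * (c + 2))%N%:R))).
  apply: ler_pM => //; rewrite ?expR_ge0 ?mulr_ge0 //; last by rewrite ler_expR lerN2.
  by rewrite expr2 ler_pM2l // ler_nat.
rewrite expRN -[leLHS]/(_ / _) ler_pdivrMr ?expR_gt0 // ler_pdivlMl ?exprn_gt0 //.
rewrite -exprD.
apply: (@le_trans _ _ ((2 ^ ((2 * D + 10) * q))%N%:R ^+ (c + 2))).
  by apply: lerXn2r; rewrite ?nnegrE ?ler0n // ler_nat size_leq_exp.
rewrite natrX -exprM -[X in expR X]mulr1 expRM_natl; apply: lerXn2r; rewrite ?nnegrE ?expR_ge0 //.
by apply: le_trans (expR_ge1Dx 1); rewrite -natr1.
Qed.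

Lemma success_probability :
  1 - (n%:R ^+ c)^-1 <= coin_prob R (time_bound n D) (success e adj D).
Proof.
set q := qlog D n; set k := degeneracy e.
have [sp|] := boolP ((q == 0%N) || (k < tau D q)%N).
  rewrite coin_prob_mean (_ : (fun w => _) = fun=> 1); last first.
    apply/funext => w; case: asboolP => // h; exfalso; apply: h.
    exact: success_sparse sp.
  by rewrite coin_mean_cst lerBlDr lerDl invr_ge0 exprn_ge0.
rewrite negb_or -lt0n -leqNgt => /andP[q0 hk].
have [rk [inj hrk]] := degenerate_rank (degenerate_degeneracy e).
set gam := (n %/ 2 ^ q + 1)%N; set d := block_degree e D.
pose bad (p : 'I_n * 'I_(2 ^ q)) (w : nat -> bool) : R :=
  (d < block_count (later e rk p.1) (2 ^ q) gam p.2 (fun g => coin_val w (g * q) q))%N%:R.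
(* Pointwise union bound: a failure forces the count of some vertex and label above [d]. *)
have cover w : 1 <= (`[< success e adj D w >])%:R + \sum_p bad p w.
  have bad0 p : 0 <= bad p w by rewrite ler0n.
  case: asboolP => [_|h]; first by rewrite lerDl sumr_ge0.
  rewrite add0r; have [p hp] : exists p, bad p w = 1.
    apply: contrapT => hn; apply: h.
    apply: (success_of_blocks n0 ge ha inj hk (block_degree_colors n0 q0 hk)) => u b hb.
    rewrite leqNgt; apply/negP => hlt; apply: hn; exists (u, Ordinal hb).
    by rewrite /bad /= hlt.
  by rewrite (bigD1 p) //= hp lerDl sumr_ge0.
have := coin_mean_le (time_bound n D) cover.
rewrite coin_mean_cst coin_meanD coin_mean_sum -coin_prob_mean => h.
rewrite lerBlDr; apply: le_trans h _; rewrite lerD2l.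
apply: le_trans (tail_bound q0 hk).
apply: (@le_trans _ _ (\sum_(p : 'I_n * 'I_(2 ^ q))
    expR (- ((3 * q%:R)^-1 ^+ 2 * k%:R / 2 ^+ q)))); last first.
  by rewrite sumr_const card_prod !card_ord -[leLHS]mulr_natl natrM.
apply: ler_sum => p _.
rewrite -(subnKC (coins_leq_time n D)) -/q -/gam; apply: block_count_tail.
- exact: count_later (hrk p.1) (iota_uniq _ _).
- have qR : 1 <= (q%:R : R) by rewrite ler1n.
  rewrite invr_ge0 mulr_ge0 //= lef_pV2 ?posrE; lra.
- have qR : 0 < (q%:R : R) by rewrite ltr0n.
  have lR : 0 < (2 : R) ^+ q by rewrite exprn_gt0.
  (* With [eps = 1 / (3 * q)] the factor [1 + 3 * eps] is [(q + 1) / q], so the threshold is the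
     fraction whose floor is [d]. *)
  have -> : (1 + 3 * (3 * q%:R)^-1) * k%:R / 2 ^+ q = (k * q.+1)%N%:R / (q * 2 ^ q)%N%:R :> R.
    rewrite !natrM natrX -natr1; field.
    by rewrite !gt_eqF.
  rewrite ler_pdivrMr -?natrM ?ler_nat ?ltr0n ?muln_gt0 ?q0 ?expn_gt0 //.
  by apply/ltnW/ltn_ceil; rewrite muln_gt0 q0 expn_gt0.
Qed.

End SuccessProbability.

(** * Asymptotics *)

Lemma natr_div_le (R : realType) (a b : nat) : ((a %/ b)%N%:R : R) <= a%:R / b%:R.
Proof.
case: (posnP b) => [->|b0]; first by rewrite divn0 invr0 mulr0.
by rewrite ler_pdivlMr ?ltr0n // -natrM ler_nat leq_divM.
Qed.

Lemma surplus_little_o (R : realType) D :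
  little_o (fun k => (surplus D k)%:R : R) (fun k => k%:R).
Proof.
(* For [k >= m] and [qlog D k >= m] the surplus is at most [2 * k / m + 1 <= 3 * k / m], below
   [eps * k] as [m > 4 / eps]. *)
apply/eqoP => eps eps0; set m := Num.bound (4 / eps).
have hm : 4 / eps < m%:R by apply: archi_boundP; rewrite divr_ge0 // ltW.
have m0 : 0 < (m%:R : R) by apply: le_lt_trans hm; rewrite divr_ge0 // ltW.
have m1 : (0 < m)%N by rewrite ltr0n in m0.
exists (maxn (tau D m ^ 2) m) => // k /=; rewrite geq_max => /andP[/qlog_ge hq hk].
rewrite !ger0_norm // /surplus ifN; last by rewrite -lt0n (leq_trans m1).
have q0 : (0 < qlog D k)%N by apply: leq_trans hq.
rewrite natrD; have := natr_div_le R (2 * k) (qlog D k).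
have hkm : 1 <= (k%:R : R) / m%:R by rewrite ler_pdivlMr // mul1r ler_nat.
have h1 : (2 * k)%N%:R / (qlog D k)%:R <= 2 * (k%:R / m%:R) :> R.
  rewrite natrM -mulrA ler_pM2l // ler_wpM2l // lef_pV2 ?posrE ?ltr0n ?ler_nat //.
have h2 : (k%:R : R) / m%:R <= k%:R * (eps / 4).
  by rewrite ler_wpM2l // -[eps / 4]invrK lef_pV2 ?posrE ?invr_gt0 ?divr_gt0 // invf_div ltW.
have k0 : 0 <= (k%:R : R) by [].
nra.
Qed.

(** [ln 2 >= 1/2], from [exp (- 1/2) >= 1/2], gives [trunc_log 2 n <= 2 * ln n]; the extra bit costs
    at most [2 * ln n] more. *)
Lemma ln_bitlen (R : realType) n : (1 < n)%N -> ((bitlen n)%:R : R) <= 4 * ln n%:R.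
Proof.
move=> n1; have ln2 : 2^-1 <= ln (2 : R).
  rewrite -[leLHS]expRK ler_ln ?posrE ?expR_gt0 //.
  have h : 2^-1 <= expR (- 2^-1 : R) by apply: le_trans (expR_ge1Dx _); lra.
  by rewrite -[2^-1]opprK expRN -[leRHS]invrK lef_pV2 ?posrE ?expR_gt0.
have nR : 0 < (n%:R : R) by rewrite ltr0n ltnW.
have l2 : ln (2 : R) <= ln n%:R by rewrite ler_ln ?posrE // ler_nat.
have h : (trunc_log 2 n)%:R * ln (2 : R) <= ln n%:R.
  rewrite mulr_natl -lnXn // ler_ln ?posrE ?exprn_gt0 // -natrX ler_nat.
  exact: trunc_logP (ltnW n1).
rewrite /bitlen -natr1; have t0 : 0 <= ((trunc_log 2 n)%:R : R) by [].
nra.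
Qed.

Lemma soft_O_bitlen (R : realType) (g : nat -> nat) (C : nat) :
  (forall n, (0 < n)%N ->
     ((g n)%:R : R) <= C%:R * (n%:R * Num.sqrt n%:R) * (bitlen n)%:R ^+ 4) ->
  soft_O (fun n => (g n)%:R : R) (fun n => n%:R `^ (3 / 2)).
Proof.
move=> hg; exists 4%N; apply/eqO_exP; exists (C%:R * 256 + 1 : R).
  by rewrite ltr_wpDl ?mulr_ge0.
exists 2%N => // n /= n2; have n0 : (0 < n)%N by apply: ltnW.
have nR : 0 < (n%:R : R) by rewrite ltr0n.
have -> : n%:R `^ (3 / 2) = n%:R * Num.sqrt n%:R :> R.
  have -> : 3 / 2 = 1 + 2^-1 :> R by lra.
  by rewrite powRD ?powRr1 ?powR12_sqrt ?ltW //; apply/implyP => _; rewrite gt_eqF.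
have lb := ln_bitlen R n2.
have ln0 : 0 <= ln (n%:R : R) by rewrite ln_ge0 // ler1n.
have s0 : 0 <= n%:R * Num.sqrt n%:R :> R by rewrite mulr_ge0 ?sqrtr_ge0.
have L0 : 0 <= ln n%:R ^+ 4 :> R by rewrite exprn_ge0.
rewrite !ger0_norm ?mulr_ge0 //; apply: le_trans (hg n n0) _.
have hL : (bitlen n)%:R ^+ 4 <= 256 * ln n%:R ^+ 4 :> R.
  have -> : 256 * ln n%:R ^+ 4 = (4 * ln n%:R) ^+ 4 :> R by ring.
  by apply: lerXn2r; rewrite ?nnegrE ?mulr_ge0.
apply: (@le_trans _ _ (C%:R * (n%:R * Num.sqrt n%:R) * (256 * ln n%:R ^+ 4))).
  by rewrite ler_wpM2l // mulr_ge0.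
have : 0 <= n%:R * Num.sqrt n%:R * ln n%:R ^+ 4 :> R by rewrite mulr_ge0.
lra.
Qed.

Lemma qlog_lt_bitlen D n : (0 < n)%N -> (qlog D n < bitlen n)%N.
Proof. by move=> n0; rewrite ltnS trunc_log_max // exp2_qlog_leq_pos. Qed.

(** Maximality of [q] is used from both sides: [tau D q <= sqrt n] bounds the reading, and
    [sqrt n < tau D q.+1] bounds [n / l] by [sqrt n] times a multiple of [(q + 1) ^ 3]. *)
Lemma fuel_bound_le (R : realType) D : exists C : nat, forall n, (0 < n)%N ->
  ((fuel_bound n D)%:R : R) <= C%:R * (n%:R * Num.sqrt n%:R) * (bitlen n)%:R ^+ 3.
Proof.
(* The summands [4 * n * tau], [2 * n * (n / l)], [4 * n] and 1 contribute 4, [4 * 2 ^ D], 4 and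
   1. *)
exists (9 + 4 * 2 ^ D)%N => n n0; rewrite /fuel_bound.
have n1 : 1 <= (n%:R : R) by rewrite ler1n.
set q := qlog D n; set s := Num.sqrt _; set lam := (bitlen n)%:R.
have ss : s * s = n%:R by rewrite -expr2 sqr_sqrtr.
have s1 : 1 <= s by rewrite -[leLHS]sqrtr1 ler_wsqrtr.
have qlam : q.+1%:R <= lam :> R by rewrite ler_nat qlog_lt_bitlen.
have lam1 : 1 <= lam by rewrite ler1n.
have lam3 : 1 <= lam ^+ 3 by rewrite exprn_ege1.
have taus : (tau D q)%:R <= s.
  rewrite -[leLHS]ger0_norm // -sqrtr_sqr ler_sqrt ?ltr0n // -natrX ler_nat.
  exact: tau_qlog_leq.
have lR : 0 < (2 ^ q)%N%:R :> R by rewrite ltr0n expn_gt0.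
have sl : s <= 2 * 2 ^+ D * lam ^+ 3 * (2 ^ q)%N%:R.
  apply: (@le_trans _ _ (tau D q.+1)%:R).
    rewrite -[leRHS]ger0_norm // -sqrtr_sqr ler_wsqrtr // -natrX ler_nat ltnW //.
    exact: ltn_tau_qlog.
  have -> : (tau D q.+1)%:R = 2 * 2 ^+ D * q.+1%:R ^+ 3 * (2 ^ q)%N%:R :> R.
    by rewrite /tau !natrM !natrX (exprS _ q); ring.
  rewrite ler_pM2r // ler_pM2l ?mulr_gt0 ?exprn_gt0 //.
  by apply: lerXn2r; rewrite ?nnegrE ?ler0n // (le_trans _ lam1).
have hg : ((n %/ 2 ^ q)%N%:R : R) <= s * (2 * 2 ^+ D * lam ^+ 3).
  apply: le_trans (natr_div_le _ _ _) _; rewrite ler_pdivrMr // -ss.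
  by rewrite -[leRHS]mulrA ler_wpM2l // sqrtr_ge0.
move: (tau D q) taus => t taus; rewrite !(natrD, natrM) natrX.
have D0 : 0 < (2 : R) ^+ D by rewrite exprn_gt0.
set g := (n %/ _)%:R in hg *; set x := (2 : R) ^+ D in D0 sl hg *.
set y := lam ^+ 3 in lam3 sl hg *; set N := (n%:R : R) in n1 ss *.
have N0 : 0 <= N by lra.
have e1 : N * t%:R <= N * s * y.
  rewrite -mulrA ler_wpM2l //; nra.
have e2 : N * g <= N * s * y * (2 * x).
  have -> : N * s * y * (2 * x) = N * (s * (2 * x * y)) by ring.
  by rewrite ler_wpM2l.
have e3 : N <= N * s * y by rewrite -mulrA ler_peMr //; nra.
lra.
Qed.

(** Values are at most [32 * n ^ 2], of length at most [6 + 2 * bitlen n]. *)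
Lemma bitlen_value_bound D n : (0 < n)%N -> (bitlen (value_bound n D) <= 8 * bitlen n)%N.
Proof.
move=> n0; have b1 := bitlen_gt0 n.
have q1 := exp2_qlog_leq D n; have tq := tau_qlog_leq D n.
have tn : (tau D (qlog D n) <= n)%N by nia.
have dn := leq_div n (2 ^ qlog D n).
have h : (value_bound n D <= 32 * (n * n))%N.
  rewrite /value_bound /fuel_bound.
  move: (tau _ _) (2 ^ _)%N (n %/ _)%N tn q1 dn {tq} => t x y tn xn yn; nia.
apply: leq_trans (leq_bitlen h) _.
apply: leq_trans (bitlen_binop Mul 32 (n * n)) _.
have := bitlen_binop Mul n n => /=.
have -> : bitlen 32 = 6%N by [].
by move: (bitlen (n * n)) => z; lia.
Qed.

Lemma time_bound_le (R : realType) D : exists C : nat, forall n, (0 < n)%N ->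
  ((time_bound n D)%:R : R) <= C%:R * (n%:R * Num.sqrt n%:R) * (bitlen n)%:R ^+ 4.
Proof.
have [C hC] := fuel_bound_le R D; set K := kost (coloring_prog (2 ^ D)).
exists (K * 8 * C)%N => n n0; rewrite /time_bound -/K natrM natrM.
have -> : (K * 8 * C)%N%:R * (n%:R * Num.sqrt n%:R) * (bitlen n)%:R ^+ 4 =
    K%:R * ((8 * bitlen n)%N%:R * (C%:R * (n%:R * Num.sqrt n%:R) * (bitlen n)%:R ^+ 3)) :> R.
  by rewrite !natrM; ring.
rewrite ler_wpM2l //; apply: ler_pM => //; last exact: hC.
by rewrite ler_nat bitlen_value_bound.
Qed.

Theorem theorem4p2 (R : realType) (c : nat) :
  exists (prog : cmd) (f Q T S : nat -> nat),
    [/\ little_o (fun k => (f k)%:R : R) (fun k => k%:R),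
        soft_O (fun n => (Q n)%:R : R) (fun n => n%:R `^ (3 / 2)),
        soft_O (fun n => (T n)%:R : R) (fun n => n%:R `^ (3 / 2)),
        soft_O (fun n => (S n)%:R : R) (fun n => n%:R `^ (3 / 2)) &
        forall (n : nat) (e : rel 'I_n) (adj : 'I_n -> seq 'I_n),
          (0 < n)%N -> simple_graph e -> adjacency_lists e adj ->
          (forall w : nat -> bool, exists s : state,
             [/\ run e adj prog w s,
                 (st_queries s <= Q n)%N,
                 (st_time s <= T n)%N &
                 (st_space s <= S n)%N]) /\
          1 - (n%:R ^+ c)^-1 <=
            coin_prob R (T n) (fun w => exists s : state,
              [/\ run e adj prog w s,
                  proper_coloring e (@output_coloring n s) &
                  (num_colors (@output_coloring n s) <=
                     degeneracy e + f (degeneracy e))%N])].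
Proof.
pose D := (c + 12)%N; pose T n := time_bound n D.
exists (coloring_prog (2 ^ D)), (surplus D), T, T, (fun n => bitlen n + 1 + T n)%N.
have [C hC] := time_bound_le R D.
have sT := soft_O_bitlen hC.
split=> //; first exact: surplus_little_o.
  (* The space bound is the time plus the [bitlen n + 1] bits of the initial memory. *)
  apply: (@soft_O_bitlen _ _ (2 + C)) => n n0.
  have n1 : 1 <= (n%:R : R) by rewrite ler1n.
  have s1 : 1 <= Num.sqrt (n%:R : R) by rewrite -[leLHS]sqrtr1 ler_wsqrtr.
  have b1 : 1 <= ((bitlen n)%:R : R) by rewrite ler1n.
  have := hC n n0; rewrite !natrD !mulrDl.
  have ns : 1 <= n%:R * Num.sqrt (n%:R : R) by rewrite mulr_ege1.
  have b3 : 1 <= (bitlen n)%:R ^+ 3 :> R by rewrite exprn_ege1.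
  have h : (bitlen n)%:R <= n%:R * Num.sqrt n%:R * (bitlen n)%:R ^+ 4 :> R.
    by rewrite exprSr mulrA ler_peMl ?ler0n // mulr_ege1.
  by rewrite -!/(T n); lra.
move=> n e adj n0 ge ha; split; last exact: success_probability.
move=> w; have [s [hs ht _]] := prog_spec ge ha D w.
have mem0 : memory_size (st_mem (input_state n)) (st_cells (input_state n)) =
    (bitlen n + 1)%N.
  by rewrite /memory_size big_seq1 /= /update /= [bitlen 0]/bitlen trunc_log0 addnC.
have [|_ h1 h2] := exec_resources (K := (bitlen n + 1)%N) hs.
  by split; rewrite // -mem0 leq_addr.
by exists s; split=> //; [apply: leq_trans ht | apply: leq_trans h1 _; rewrite leq_add2l].
Qed.
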